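(* Let $E$ be a separable real Hilbert space and let $1\leq p<\infty$ be such that $p$ is not an even integer. If $\Phi\colon\mathcal{W}_p(E)\to\mathcal{W}_p(E)$ is an isometry (distance preserving bijection), then there exists an (affine) isometry $\psi\colon E\to E$ such that $\Phi(\mu)=\psi_\#\mu$ for all $\mu\in\mathcal{W}_p(E)$.
   Context: For $1\le p<\infty$, $\mathcal{W}_p(E)$ is the set of Borel probability measures $\mu$ on $E$ with $\int_E\|x\|^p\,d\mu(x)<\infty$, equipped with $d_{\mathcal{W}_p}(\mu,\nu)=\big(\inf_{\pi\in\Pi(\mu,\nu)}\int_{E\times E}\|x-y\|^p\,d\pi(x,y)\big)^{1/p}$, where $\Pi(\mu,\nu)$ is the set of Borel probability measures on $E\times E$ with marginals $\mu$ and $\nu$. For a measurable $g\colon E\to E$, the push-forward is $(g_\#\mu)(A)=\mu(g^{-1}[A])$ for Borel $A$. *)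

(* Defs.v *)
From HB Require Import structures.
From mathcomp Require Import all_boot all_order all_algebra.
From mathcomp Require Import all_classical all_reals all_analysis.
Set Implicit Arguments. Unset Strict Implicit. Unset Printing Implicit Defensive.
Import Order.TTheory GRing.Theory Num.Theory.
Import numFieldNormedType.Exports.
Local Open Scope classical_set_scope.
Local Open Scope ring_scope.

Definition inner_product_inducing_norm (R : realType) (E : normedModType R)
    (ip : E -> E -> R) : Prop :=
  [/\ (forall x y, ip x y = ip y x),
      (forall (a : R) (x y z : E), ip (a *: x + y) z = a * ip x z + ip y z)
    & (forall x, `|x| = Num.sqrt (ip x x))].

Definition hilbert_space (R : realType) (E : completeNormedModType R) : Prop :=
  exists ip : E -> E -> R, inner_product_inducing_norm ip.

Definition separable_space (T : topologicalType) : Prop :=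
  exists D : set T, countable D /\ dense D.

Definition borel (R : realType) (E : normedModType R) :=
  g_sigma_algebraType (@open E).

Section Wasserstein.
Variables (R : realType) (E : normedModType R).
Local Notation BE := (borel E).

Definition normE (x : E) : R := `|x|.
Definition distE (x y : E) : R := `|x - y|.

Definition Wp (p : R) : set (probability BE R) :=
  [set mu | (\int[mu]_(x in [set: BE]) ((normE x) `^ p)%:E < +oo)%E].

Definition coupling (mu nu : probability BE R)
    (pi : probability (BE * BE)%type R) : Prop :=
  forall A : set BE, measurable A ->
    pi (A `*` setT) = mu A /\ pi (setT `*` A) = nu A.

Definition transport_cost (p : R) (pi : probability (BE * BE)%type R) : \bar R :=
  (\int[pi]_(z in [set: (BE * BE)%type]) ((distE z.1 z.2) `^ p)%:E)%E.

(* The p-Wasserstein distance (for mu, nu in W_p(E) the infimum is finite). *)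
Definition wasserstein (p : R) (mu nu : probability BE R) : R :=
  (fine (ereal_inf [set transport_cost p pi |
     pi in [set pi | coupling mu nu pi]])) `^ p^-1.

End Wasserstein.

(* Main.v *)
(** A Dirac mass is characterised metrically: from [delta_x] every [nu] can be
    overshot, i.e. some [eta] (the dilation of [nu] by 2 about [x]) satisfies
    [W(eta,delta_x) >= 2 W(nu,delta_x)] and [W(eta,nu) <= W(nu,delta_x)].
    Conversely, if [mu] has two support points [a <> b] and [nu] is the Dirac
    mass at their midpoint [y], then the product coupling shows that such an
    [eta] forces [|z - x| = |z - y| + |y - x|] for almost all [(z,x)]; a single
    [z <> y] then puts [a] and [b] on the same ray from [y], which is absurd.
    So [Phi] permutes the Dirac masses through an isometry [psi] of [E], which
    is affine because [E] is a Hilbert space.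

    Distances to Dirac masses show that [Phi mu] and [psi # mu] have the same
    potential [x |-> int |x - y|^p].  For [p] not an even integer the potential
    determines the atoms: fix a unit vector [e] and a finite difference in [s]
    that kills polynomials of degree well above [p] but not [|s|^p]; applied to
    [s |-> |w + s e|^p] it gives a function of [w] that vanishes at infinity but
    not at [0], and integrating it at [w = c (x - y)] against [mu] isolates the
    mass of [x] as [c] tends to infinity.  Hence [Phi mu = psi # mu] for purely
    atomic [mu]; these are dense, and Markov's inequality on closed sets passes
    the identity to the limit. *)

Require Import Defs.
From HB Require Import structures.
From mathcomp Require Import all_boot all_order all_algebra.
From mathcomp Require Import all_classical all_reals all_analysis.
From mathcomp Require Import measurable_realfun ring lra.
Import Order.TTheory GRing.Theory Num.Theory.
Import numFieldNormedType.Exports.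
Local Open Scope classical_set_scope.
Local Open Scope ring_scope.

Set Implicit Arguments.
Unset Strict Implicit.
Unset Printing Implicit Defensive.

(** * Dilation differences *)

Section DilationDifference.
Variable R : comNzRingType.
Implicit Types (g h : R -> R) (s t a : R) (k n : nat).

(* The factor [g (2 t) - 4^j g t] kills even monomials [t^(2j)] and multiplies
   [|t|^p] by [2^p - 4^j], which is nonzero unless [p = 2j]. *)
Fixpoint dildiff k g t : R :=
  if k is k'.+1 then dildiff k' g (2 * t) - 4 ^+ k' * dildiff k' g t
  else g t + g (- t).

Lemma eq_dildiff k g h t : g =1 h -> dildiff k g t = dildiff k h t.
Proof. by move=> gh; elim: k t => [|k IH] t /=; rewrite ?gh ?IH. Qed.

Lemma dildiffB k g h t :
  dildiff k (fun s => g s - h s) t = dildiff k g t - dildiff k h t.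
Proof. by elim: k t => [|k IH] t /=; rewrite ?IH; ring. Qed.

Lemma dildiffZ k a g t : dildiff k (fun s => a * g s) t = a * dildiff k g t.
Proof. by elim: k t => [|k IH] t /=; rewrite ?IH; ring. Qed.

Lemma dildiff_sum k (I : Type) (r : seq I) (F : I -> R -> R) t :
  dildiff k (fun s => \sum_(i <- r) F i s) t = \sum_(i <- r) dildiff k (F i) t.
Proof.
elim: k t => [|k IH] t /=; first by rewrite big_split.
by rewrite !IH mulr_sumr sumrB.
Qed.

Lemma dildiff_scale k a g t :
  dildiff k (fun s => g (a * s)) t = dildiff k g (a * t).
Proof.
elim: k t => [|k IH] t /=; first by rewrite mulrN.
by rewrite !IH mulrCA.
Qed.

Lemma dildiff_eigen k a g t : (forall s, g (2 * s) = a * g s) ->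
  dildiff k g t = \prod_(j < k) (a - 4 ^+ j) * (g t + g (- t)).
Proof.
move=> ga; elim: k t => [|k IH] t /=; first by rewrite big_ord0 mul1r.
by rewrite !IH big_ord_recr /= -mulrN !ga; ring.
Qed.

Lemma dildiff_exp k n t : (n < k.*2)%N -> dildiff k (fun s => s ^+ n) t = 0.
Proof.
move=> nk; rewrite (@dildiff_eigen _ (2 ^+ n)); last first.
  by move=> s; rewrite exprMn.
have [odd_n|even_n] := boolP (odd n).
  by rewrite exprNn -signr_odd odd_n expr1 mulN1r subrr mulr0.
have nE : n = (n./2).*2 by rewrite even_halfK.
have n2k : (n./2 < k)%N by rewrite -ltn_double -nE.
rewrite (bigD1 (Ordinal n2k)) //= [in X in X - _]nE -mul2n exprM -natrX.
by rewrite subrr !mul0r.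
Qed.

Lemma dildiff_poly k (P : {poly R}) t :
  (size P <= k.*2)%N -> dildiff k (horner P) t = 0.
Proof.
move=> sP; rewrite (eq_dildiff _ _ (fun s => horner_coef_wide s sP)).
rewrite dildiff_sum.
by apply: big1 => i _; rewrite dildiffZ dildiff_exp// mulr0.
Qed.

End DilationDifference.

Lemma dildiff_bound (R : realDomainType) k : exists2 C : R, 0 <= C &
  forall (g : R -> R) (t M : R),
    (forall s, `|s| <= 2 ^+ k * `|t| -> `|g s| <= M) ->
  `|dildiff k g t| <= C * M.
Proof.
elim: k => [|k [C C0 IH]].
  exists 2 => // g t M gM /=; rewrite mulr_natl mulr2n.
  by rewrite (le_trans (ler_normD _ _))// lerD// gM// ?normrN mul1r.
exists ((1 + 4 ^+ k) * C); first by rewrite mulr_ge0// addr_ge0// exprn_ge0.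
move=> g t M gM /=; rewrite (le_trans (ler_normB _ _))//.
have -> : (1 + 4 ^+ k) * C * M = C * M + 4 ^+ k * (C * M) by ring.
rewrite lerD//.
  apply: IH => s; rewrite normrM ger0_norm// mulrCA mulrA -exprS; exact: gM.
rewrite normrM ger0_norm ?exprn_ge0// ler_wpM2l ?exprn_ge0//.
apply: IH => s /le_trans st; apply/gM/st; rewrite ler_wpM2r// exprS.
by rewrite ler_peMl ?exprn_ge0// ler1n.
Qed.

(** * Taylor expansion of powers *)

Lemma poly_antiderivative (R : numFieldType) (P : {poly R}) :
  exists Q : {poly R}, [/\ Q^`() = P, Q.[0] = 0 & (size Q <= (size P).+1)%N].
Proof.
exists (\poly_(i < (size P).+1) (if i is j.+1 then P`_j / j.+1%:R else 0)).
split.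
- apply/polyP => i; rewrite coef_deriv coef_poly ltnS.
  case: ltnP => iP; last by rewrite mul0rn nth_default.
  by rewrite -[LHS]mulr_natr divfK// pnatr_eq0.
- by rewrite horner_coef0 coef_poly.
- exact: size_poly.
Qed.

Lemma size_comp_poly2 (R : idomainType) (P q : {poly R}) n :
  (size P <= n)%N -> (size q <= 3)%N -> (size (P \Po q) <= n.*2)%N.
Proof.
have [->|P0] := eqVneq P 0; first by rewrite comp_poly0 size_poly0.
move=> Pn q3; rewrite (leq_trans (size_comp_poly_leq _ _))//.
move: Pn; rewrite (polySpred P0) /=; case: n => // n; rewrite ltnS => Pn.
have q2 : ((size q).-1 <= 2)%N by case: (size q) q3.
by rewrite doubleS -muln2 ltnS ltnW// ltnS leq_mul.
Qed.

Section Taylor.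
Variable R : realType.
Implicit Types (f df : R -> R) (u v x y a c : R).

Lemma MVT_segment_le f df M x y : x <= y ->
  (forall v, x <= v <= y -> is_derive v 1 f (df v)) ->
  (forall v, x <= v <= y -> `|df v| <= M) -> `|f y - f x| <= M * (y - x).
Proof.
move=> xy fdf dfM.
have fc : {within `[x, y], continuous f}.
  apply: derivable_within_continuous => v; rewrite in_itv/= => /fdf dv.
  exact: ex_derive.
have fdf_oo v : v \in `]x, y[ -> is_derive v 1 f (df v).
  by move/subset_itv_oo_cc; rewrite in_itv; exact: fdf.
have [v + ->] := MVT_segment xy fdf_oo fc.
rewrite in_itv/= => vxy.
by rewrite normrM [`|y - x|]ger0_norm ?subr_ge0// ler_wpM2r ?subr_ge0// dfM.
Qed.

Lemma MVT_ball_le f df M u :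
  (forall v, `|v| <= `|u| -> is_derive v 1 f (df v)) ->
  (forall v, `|v| <= `|u| -> `|df v| <= M) -> `|f u - f 0| <= M * `|u|.
Proof.
move=> fdf dfM; have [u0|/ltW u0] := leP 0 u.
  rewrite [`|u|]ger0_norm// -[X in M * X]subr0.
  apply: (MVT_segment_le u0) => v /andP[v0 vu];
    by [apply: fdf; rewrite !ger0_norm|apply: dfM; rewrite !ger0_norm].
rewrite distrC [`|u|]ler0_norm// -[- u]sub0r.
apply: (MVT_segment_le u0) => v /andP[uv v0];
  by [apply: fdf; rewrite !ler0_norm ?lerN2
     |apply: dfM; rewrite !ler0_norm ?lerN2].
Qed.

Lemma powR1D_bounded a : exists2 C : R, 0 <= C &
  forall u, `|u| <= 2^-1 -> `|(1 + u) `^ a| <= C.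
Proof.
exists (2 `^ `|a|) => [|u]; first exact: powR_ge0.
rewrite ler_norml => /andP[u_ge u_le]; have u0 : 0 < 1 + u by lra.
rewrite ger0_norm ?powR_ge0// /powR !gt_eqF// ler_expR.
apply: le_trans (ler_norm _) _; rewrite normrM ler_wpM2l// ler_norml.
rewrite lerNl -lnV ?posrE// !ler_ln ?posrE ?invr_gt0//.
rewrite -[X in _ <= X]invrK lef_pV2 ?posrE ?invr_gt0//.
by apply/andP; split; lra.
Qed.

Lemma is_derive_powR1D a v : 0 < 1 + v ->
  is_derive v 1 (fun w => (1 + w) `^ a) (a * (1 + v) `^ (a - 1)).
Proof.
move=> v0; have shift : is_derive v 1 (fun w : R => 1 + w) (0 + 1).
  exact: is_deriveD.
have dpow := is_derive1_powR a v0.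
apply: is_derive_eq (is_derive1_comp dpow shift) _.
by rewrite add0r mulr1.
Qed.

Lemma powR1D_taylor n a : exists (P : {poly R}) (C : R),
  [/\ (size P <= n)%N, 0 <= C &
      forall u, `|u| <= 2^-1 -> `|(1 + u) `^ a - P.[u]| <= C * `|u| ^+ n].
Proof.
elim: n a => [|n IH] a.
  have [C C0 powC] := powR1D_bounded a.
  exists 0, C; split; rewrite ?size_poly0// => u u2.
  by rewrite horner0 subr0 mulr1 powC.
have [P [C [sP C0 PC]]] := IH (a - 1).
have [Q [dQ Q0 sQ]] := poly_antiderivative P.
exists (1 + a *: Q), (`|a| * C); split=> [||u u2]; last 1 first.
- pose f (v : R) := (1 + v) `^ a - (1 + a *: Q).[v].
  pose df (v : R) := a * ((1 + v) `^ (a - 1) - P.[v]).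
  have f0 : f 0 = 0 by rewrite /f addr0 powR1 !hornerE Q0 mulr0 addr0 subrr.
  rewrite exprSr mulrA -[_ - _]/(f u) -[f u]subr0 -f0.
  apply: (@MVT_ball_le _ df) => v vu; have v2 := le_trans vu u2.
    have v0 : 0 < 1 + v by move: v2; rewrite ler_norml => /andP[]; lra.
    have dQv := is_derive_poly (1 + a *: Q) v.
    apply: is_derive_eq (is_deriveB (is_derive_powR1D a v0) dQv) _.
    by rewrite derivD derivZ dQ -(polyC1 R) derivC add0r hornerZ -mulrBr.
  rewrite /df normrM -mulrA ler_wpM2l// (le_trans (PC _ v2))// ler_wpM2l//.
  by rewrite lerXn2r// nnegrE.
- rewrite (leq_trans (size_polyD _ _))// geq_max size_poly1 /=.
  by rewrite (leq_trans (size_scale_leq _ _))// (leq_trans sQ).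
- by rewrite mulr_ge0.
Qed.

(* The increment [u = 2 c q + q^2] satisfies [|u| <= 3 |q| <= 1/2] on the range
   of [q] that matters: the Taylor polynomial in [u] has degree below [2 n] in
   [q], hence is killed, and the remainder is of order [q^n]. *)
Lemma dildiff_powR_quadratic n a : exists2 C : R, 0 <= C & forall c r : R,
  `|c| <= 1 -> 0 <= r -> 6 * 2 ^+ n * r <= 1 ->
  `|dildiff n (fun q => (1 + (2 * c * q + q ^+ 2)) `^ a) r| <= C * r ^+ n.
Proof.
have [P [C [sP C0 PC]]] := powR1D_taylor n a.
have [D D0 Dbound] := dildiff_bound R n.
exists (D * (C * (3 * 2 ^+ n) ^+ n)).
  by rewrite !mulr_ge0// exprn_ge0// mulr_ge0// exprn_ge0.
move=> c r c1 r0 r_small.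
pose q2 : {poly R} := (2 * c) *: 'X + 'X^2.
have q2E q : q2.[q] = 2 * c * q + q ^+ 2 by rewrite !hornerE.
have sq2 : (size q2 <= 3)%N.
  rewrite (leq_trans (size_polyD _ _))// geq_max size_polyXn andbT.
  by rewrite (leq_trans (size_scale_leq _ _))// size_polyX.
have taylor_kills : dildiff n (horner (P \Po q2)) r = 0.
  exact/dildiff_poly/size_comp_poly2.
rewrite -[X in `|X|]subr0 -taylor_kills -dildiffB -!mulrA -exprMn.
apply: Dbound => q; rewrite (ger0_norm r0) => qr; rewrite horner_comp q2E.
have q6 : 6 * `|q| <= 1 by rewrite (le_trans _ r_small)// -mulrA ler_wpM2l.
have u3q : `|2 * c * q + q ^+ 2| <= 3 * `|q|.
  rewrite (le_trans (ler_normD _ _))// !normrM ger0_norm//.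
  have : `|c| * `|q| <= `|q| by rewrite ler_piMl.
  have : `|q| * `|q| <= `|q| by rewrite ler_piMl//; have := normr_ge0 q; lra.
  by lra.
have u2 : `|2 * c * q + q ^+ 2| <= 2^-1 by rewrite (le_trans u3q)//; lra.
rewrite (le_trans (PC _ u2))// ler_wpM2l// lerXn2r ?nnegrE//.
  by rewrite !mulr_ge0// exprn_ge0.
by rewrite (le_trans u3q)// -mulrA ler_wpM2l.
Qed.

End Taylor.

(** * Geometry of inner product spaces *)

Section NormedSpace.
Variables (R : realType) (E : normedModType R).
Implicit Types x y z : E.

Lemma distEC x y : distE x y = distE y x.
Proof. exact: distrC. Qed.

Lemma distE_triangle y x z : distE x z <= distE x y + distE y z.
Proof. exact: ler_distD. Qed.

Lemma distE_ge0 x y : 0 <= distE x y.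
Proof. exact: normr_ge0. Qed.

Lemma distExx x : distE x x = 0.
Proof. by rewrite /distE subrr normr0. Qed.

Lemma distE_eq0 x y : distE x y = 0 -> x = y.
Proof. by move/normr0_eq0/subr0_eq. Qed.

Lemma ball_distE x (r : R) : ball x r = [set y | distE x y < r].
Proof. by rewrite -ball_normE. Qed.

Lemma continuous_distE_r x : continuous (distE x).
Proof.
move=> y; apply: cvg_norm.
by apply: cvgB; [exact: cvg_cst|exact: cvg_id].
Qed.

Definition between x y z := distE x z = distE x y + distE y z.

Definition midpoint x y : E := 2^-1 *: x + (1 - 2^-1) *: y.

Definition isometric (f : E -> E) := forall x y, `|f x - f y| = `|x - y|.

Lemma isometric_surj_bij (f : E -> E) :
  isometric f -> (forall y, exists x, f x = y) -> bijective f.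
Proof.
move=> fI /choice[g gK]; exists g => // x.
by apply: distE_eq0; rewrite /distE -fI gK subrr normr0.
Qed.

Lemma isometric_continuous (f : E -> E) : isometric f -> continuous f.
Proof.
move=> fI x; apply/cvgrPdist_lt => eps eps0; near=> y.
rewrite fI; near: y; apply/nbhs_ballP; exists eps => //= y.
by rewrite -ball_normE.
Unshelve. all: by end_near. Qed.

End NormedSpace.

Section InnerProduct.
Variables (R : realType) (E : normedModType R) (ip : E -> E -> R).
Hypothesis ipN : inner_product_inducing_norm ip.
Implicit Types x y z c : E.

Lemma ipC x y : ip x y = ip y x. Proof. by have [] := ipN. Qed.

Let ip_linear a x y z : ip (a *: x + y) z = a * ip x z + ip y z.
Proof. by have [] := ipN. Qed.

Lemma ip0 z : ip 0 z = 0.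
Proof. by have := ip_linear 1 0 0 z; rewrite scale1r addr0; lra. Qed.

Lemma ipD x y z : ip (x + y) z = ip x z + ip y z.
Proof. by rewrite -[x in LHS]scale1r ip_linear mul1r. Qed.

Lemma ipZ a x z : ip (a *: x) z = a * ip x z.
Proof. by rewrite -[a *: x]addr0 ip_linear ip0 addr0. Qed.

Lemma ip_norm x : ip x x = `|x| ^+ 2.
Proof.
have [_ _ norm_ip] := ipN; rewrite norm_ip.
have [xx0|xx0] := leP 0 (ip x x); first by rewrite sqr_sqrtr.
have /normr0_eq0 x0 : `|x| = 0 by rewrite norm_ip ltr0_sqrtr.
by move: xx0; rewrite x0 ip0 ltxx.
Qed.

Lemma sqr_normD x y : `|x + y| ^+ 2 = `|x| ^+ 2 + 2 * ip x y + `|y| ^+ 2.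
Proof. by rewrite -!ip_norm ipD ![ip _ (x + y)]ipC !ipD (ipC y x); ring. Qed.

Lemma ip_le x y : `|ip x y| <= `|x| * `|y|.
Proof.
have le_ip z : ip z y <= `|z| * `|y|.
  have := ler_normD z y; rewrite -ler_sqr ?nnegrE ?addr_ge0//.
  by rewrite sqr_normD sqrrD; lra.
rewrite ler_norml le_ip andbT lerNl -[- ip x y]mulN1r -ipZ.
by rewrite (le_trans (le_ip _))// normrZ normrN1 mul1r.
Qed.

Lemma sqr_dist_convex t x y c :
  `|t *: x + (1 - t) *: y - c| ^+ 2 =
  t * `|x - c| ^+ 2 + (1 - t) * `|y - c| ^+ 2 - t * (1 - t) * `|x - y| ^+ 2.
Proof.
have -> : t *: x + (1 - t) *: y - c = t *: (x - c) + (1 - t) *: (y - c).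
  by rewrite !scalerBr addrACA -opprD -scalerDl [t + _]addrC subrK scale1r.
have -> : x - y = (x - c) - (y - c) by rewrite opprB addrA subrK.
move: (x - c) (y - c) => {}x {}y.
rewrite !sqr_normD !normrZ normrN ipZ (ipC x (_ *: y)) ipZ (ipC x (- y)).
by rewrite -(scaleN1r y) ipZ (ipC y x) !exprMn !real_normK ?num_real//; ring.
Qed.

Lemma isometric_affine (f : E -> E) : isometric f -> forall x y t,
  f (t *: x + (1 - t) *: y) = t *: f x + (1 - t) *: f y.
Proof.
move=> fI x y t; apply/esym/subr0_eq/normr0_eq0/eqP.
by rewrite -sqrf_eq0 sqr_dist_convex !fI -sqr_dist_convex subrr normr0 expr0n.
Qed.

(* With [d = |z - m|], [h = |m - a|] and [h' = |m - b|], the median formula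
   gives [d^2 = (d + h)^2 / 2 + (d + h')^2 / 2 - |a - b|^2 / 4], and the same
   formula at [a] and [b] reduces this to [d (h + h') = 0]. *)
Lemma between_midpoint a b z :
  between z (midpoint a b) a -> between z (midpoint a b) b ->
  a = b \/ z = midpoint a b.
Proof.
rewrite /between; set m := midpoint a b => zma zmb.
have median c : distE c m ^+ 2 =
    (distE c a ^+ 2 + distE c b ^+ 2) / 2 - distE a b ^+ 2 / 4.
  by rewrite !(distEC c) /distE /m /midpoint sqr_dist_convex; field.
have ha := median a; have hb := median b; have := median z.
rewrite (distEC b a) !distExx expr0n/= in ha hb; rewrite !(distEC _ m) in ha hb.
rewrite zma zmb !sqrrD ha hb => dh.
have d0 := distE_ge0 z m; have dha0 := mulr_ge0 d0 (distE_ge0 m a).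
have dhb0 := mulr_ge0 d0 (distE_ge0 m b).
have /eqP : distE z m * distE m a = 0 by lra.
rewrite mulf_eq0 => /orP[|] /eqP; first by move/distE_eq0; right.
move=> ma0; left; apply/distE_eq0/eqP; rewrite -sqrf_eq0; apply/eqP.
by move: ha; rewrite ma0 expr0n/=; lra.
Qed.

End InnerProduct.

(** * The dilation kernel *)

Section DilationKernel.
Variables (R : realType) (E : normedModType R) (ip : E -> E -> R).
Hypothesis ipN : inner_product_inducing_norm ip.
Variables (p : R) (n : nat) (e : E).
Hypotheses (p0 : 0 <= p) (pn : p + 1 <= n%:R) (e1 : `|e| = 1).
Implicit Types (w z : E).

Definition dilkernel w : R := dildiff n (fun s => `|w + s *: e| `^ p) 1.

Lemma powR_norm_addZ w s : w != 0 ->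
  let c := ip w e / `|w| in let q := `|w|^-1 * s in
  `|w + s *: e| `^ p = `|w| `^ p * (1 + (2 * c * q + q ^+ 2)) `^ (p / 2).
Proof.
rewrite -normr_gt0 => w0 c q.
have powE x : `|x| `^ p = (`|x| ^+ 2) `^ (p / 2) :> R.
  by rewrite -powR_mulrn// -powRrM mulrCA divff// mulr1.
have sqrE : `|w + s *: e| ^+ 2 = `|w| ^+ 2 * (1 + (2 * c * q + q ^+ 2)).
  rewrite (sqr_normD ipN) normrZ e1 mulr1 (ipC ipN w) (ipZ ipN) (ipC ipN e).
  by rewrite real_normK ?num_real// /c /q; field; rewrite gt_eqF.
have factor_ge0 : 0 <= 1 + (2 * c * q + q ^+ 2).
  by rewrite -(pmulr_rge0 _ (exprn_gt0 2 w0)) -sqrE sqr_ge0.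
by rewrite !powE sqrE powRM ?sqr_ge0.
Qed.

Let cutoff : R := 6 * 2 ^+ n.

Let cutoff1 : 1 <= cutoff.
Proof. by rewrite /cutoff; have := exprn_ege1 n (ler1n R 2); lra. Qed.

Lemma dilkernel_bound_far : exists2 C : R, 0 <= C &
  forall w, cutoff <= `|w| -> `|dilkernel w| * `|w| <= C.
Proof.
have [C C0 taylor] := dildiff_powR_quadratic n (p / 2); exists C => // w w_far.
have wn0 : 0 < `|w| by rewrite (lt_le_trans _ w_far)// (lt_le_trans _ cutoff1).
have w0 : w != 0 by rewrite -normr_gt0.
rewrite /dilkernel (eq_dildiff _ _ (fun s => powR_norm_addZ s w0)) dildiffZ.
set c := ip w e / `|w|.
rewrite (dildiff_scale _ _ (fun q => (1 + (2 * c * q + q ^+ 2)) `^ (p / 2))).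
rewrite mulr1; set r := `|w|^-1.
have r0 : 0 < r by rewrite invr_gt0.
have r_small : cutoff * r <= 1 by rewrite ler_pdivrMr// mul1r.
have r1 : r <= 1 by rewrite (le_trans _ r_small)// ler_peMl// ltW.
have c1 : `|c| <= 1.
  rewrite normrM normfV normr_id ler_pdivrMr// mul1r.
  by have := ip_le ipN w e; rewrite e1 mulr1.
have rn : r ^+ n <= r `^ p * r.
  rewrite -powR_mulrn ?(ltW r0)// -[X in _ * X]powRr1 ?(ltW r0)//.
  by rewrite -powRD ?(gt_eqF r0) ?implybT// ger_powR// r0.
have wr : `|w| `^ p * r `^ p = 1.
  by rewrite -powRM// ?(ltW r0)// divff ?gt_eqF// powR1.
rewrite normrM ger0_norm ?powR_ge0// mulrAC.
have remainder := le_trans (taylor _ _ c1 (ltW r0) r_small) (ler_wpM2l C0 rn).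
apply: le_trans (ler_wpM2l _ remainder) _; first by rewrite mulr_ge0 ?powR_ge0.
have -> : `|w| `^ p * `|w| * (C * (r `^ p * r)) =
    C * (`|w| `^ p * r `^ p) * (`|w| * r) by ring.
by rewrite wr !mulr1 divff ?mulr1// gt_eqF.
Qed.

Lemma dilkernel_bound_near : exists2 C : R, 0 <= C &
  forall w, `|w| <= cutoff -> `|dilkernel w| <= C.
Proof.
have [D D0 Dbound] := dildiff_bound R n.
exists (D * (cutoff + 2 ^+ n) `^ p); first by rewrite mulr_ge0// powR_ge0.
move=> w w_near; apply: Dbound => s; rewrite normr1 mulr1 => sn.
rewrite ger0_norm ?powR_ge0// ge0_ler_powR ?nnegrE//.
  by rewrite addr_ge0 ?exprn_ge0// (le_trans _ cutoff1).
by rewrite (le_trans (ler_normD _ _))// lerD// normrZ e1 mulr1.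
Qed.

Lemma dilkernel_decay : exists2 C : R, 0 <= C &
  forall w, `|dilkernel w| * (1 + `|w|) <= C.
Proof.
have [C C0 far] := dilkernel_bound_far.
have [D D0 near] := dilkernel_bound_near.
have cutoff0 : 0 <= cutoff := le_trans ler01 cutoff1.
exists (2 * C + D * (1 + cutoff)).
  by rewrite addr_ge0 ?mulr_ge0// addr_ge0.
move=> w; have [w_far|/ltW w_near] := leP cutoff `|w|.
  rewrite -[leLHS]addr0 lerD ?mulr_ge0 ?addr_ge0//.
  have := far w w_far; have w1 : 1 <= `|w| := le_trans cutoff1 w_far.
  by have := ler_wpM2l (normr_ge0 (dilkernel w)) w1; lra.
by rewrite -[leLHS]add0r lerD ?mulr_ge0// ler_pM ?near// ?addr_ge0// lerD2l.
Qed.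

Lemma dilkernel_bounded : exists C : R, forall w, `|dilkernel w| <= C.
Proof.
have [C _ decay] := dilkernel_decay; exists C => w.
by apply: le_trans (decay w); rewrite ler_peMr// lerDl.
Qed.

Lemma dilkernel_cvg0 z : z != 0 ->
  (fun m : nat => dilkernel (m.+1%:R *: z)) @ \oo --> (0 : R).
Proof.
rewrite -normr_gt0 => z0; have [C C0 decay] := dilkernel_decay.
have bound_cvg0 : (fun m : nat => C / `|z| * m.+1%:R^-1 : R) @ \oo --> (0 : R).
  by rewrite -(mulr0 (C / `|z|)); apply: cvgMr; exact: cvg_harmonic.
apply: norm_cvg0; apply: squeeze_cvgr (cvg_cst 0) bound_cvg0.
apply: nearW => m; rewrite normr_ge0/= -mulrA -invfM ler_pdivlMr ?mulr_gt0//.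
apply: le_trans (decay (m.+1%:R *: z)); rewrite ler_wpM2l// normrZ ger0_norm//.
by rewrite mulrC lerDr.
Qed.

Lemma dilkernel0_neq0 : (~ exists k : nat, p = (2 * k)%:R) -> dilkernel 0 != 0.
Proof.
move=> peven; have kernelE s : `|0 + s *: e| `^ p = `|s| `^ p.
  by rewrite add0r normrZ e1 mulr1.
rewrite /dilkernel (eq_dildiff _ _ kernelE).
rewrite (@dildiff_eigen _ _ (2 `^ p)); last first.
  by move=> s; rewrite normrM ger0_norm// powRM.
rewrite normrN normr1 powR1 mulf_neq0// prodf_seq_neq0; apply/allP => j _ /=.
have -> : 4 ^+ j = 2 `^ (2 * j)%:R :> R.
  by rewrite powR_mulrn// exprM -(natrX R 2 2).
apply/negP; rewrite subr_eq0 => /eqP/(congr1 (@ln R)); rewrite !ln_powR.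
have ln2 : ln 2 != 0 :> R by rewrite gt_eqF// ln_gt0// ltr1n.
by move=> /(mulIf ln2) pE; apply: peven; exists j.
Qed.

End DilationKernel.

(** * Probability measures *)

Section Law.
Context d d' (T : measurableType d) (T' : measurableType d') (R : realType).
Variables (mu : probability T R) (f : T -> T') (mf : measurable_fun setT f).

Definition law : probability T' R := distribution mu (mfun_Sub (mem_set mf)).

Lemma ge0_integral_law (g : T' -> \bar R) : measurable_fun setT g ->
  (forall y, (0 <= g y)%E) -> (\int[law]_y g y = \int[mu]_x g (f x))%E.
Proof.
exact: (@ge0_integral_distribution _ _ _ _ _ mu (mfun_Sub (mem_set mf))).
Qed.

End Law.

(* A probability is a function on all sets, so two of them that agree as
   measures may differ outside the sigma-algebra. *)
Definition eqm d (T : measurableType d) (R : realType)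
    (mu nu : probability T R) :=
  forall A, measurable A -> mu A = nu A.

Section Probability.
Context d (T : measurableType d) (R : realType).
Implicit Types (m mu nu : probability T R) (A B D : set T).

Lemma eqm_sym mu nu : eqm mu nu -> eqm nu mu.
Proof. by move=> mn A mA; rewrite mn. Qed.

Lemma eqm_integral mu nu (f : T -> \bar R) :
  eqm mu nu -> (\int[mu]_t f t = \int[nu]_t f t)%E.
Proof. by move=> mn; apply: eq_measure_integral => A mA _; exact: mn. Qed.

Lemma integral_cst_probability m (c : \bar R) : (\int[m]_t c = c)%E.
Proof.
apply: etrans (integral_cst m measurableT c) _.
by rewrite [X in (_ * X)%E](@probability_setT _ _ _ m) mule1.
Qed.

Lemma probability1_ae m A : measurable A -> m A = 1%E <-> {ae m, forall t, A t}.
Proof.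
move=> mA; have mAC := measurableC mA; split=> [A1|/(negligibleP _ mAC) AC0].
  apply/(negligibleP _ mAC); apply: etrans (probability_setC m mA) _.
  by rewrite A1 subee.
by rewrite -[A]setCK probability_setC// AC0 sube0.
Qed.

Lemma ae_imply (m : {measure set T -> \bar R}) (P Q : T -> Prop) :
  (forall t, P t -> Q t) ->
  {ae m, forall t, P t} -> {ae m, forall t, Q t}.
Proof. exact: filterS. Qed.

Lemma ae_ex m (P : T -> Prop) : {ae m, forall t, P t} -> exists t, P t.
Proof.
move=> mP; apply: (@filter_ex _ (almost_everywhere m)) mP.
apply: ae_properfilter_algebraOfSetsType.
by rewrite [ltRHS](@probability_setT _ _ _ m) lte01.
Qed.

Lemma probability1_sub m A B : measurable A -> measurable B -> A `<=` B ->
  m A = 1%E -> m B = 1%E.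
Proof.
move=> mA mB AB /(probability1_ae _ mA) mA1.
by apply/(probability1_ae _ mB); apply: ae_imply mA1.
Qed.

Lemma probability_setI1 m A D : measurable A -> measurable D ->
  m D = 1%E -> m (A `&` D) = m A.
Proof.
move=> mA mD /(probability1_ae _ mD) D1; apply/esym.
apply: etrans (measureDI m mA mD) _.
rewrite [X in (X + _)%E](_ : _ = 0%E) ?add0e//.
apply/negligibleP; first exact: measurableD.
by apply: negligibleS D1 => t [].
Qed.

Lemma measure_countable_atoms (mu nu : {measure set T -> \bar R}) D :
  (forall x : T, measurable [set x]) -> countable D ->
  (forall x, mu [set x] = nu [set x]) -> mu D = nu D.
Proof.
move=> mT1 /countable_injP[code code_inj] atoms.
pose fiber k := D `&` code @^-1` [set k].
have fiber1 k : fiber k = set0 \/ exists x, fiber k = [set x].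
  have [->|/set0P[x [Dx xk]]] := eqVneq (fiber k) set0; [by left|right].
  exists x; apply/seteqP; split=> [y [Dy yk]|_ ->//].
  by apply: code_inj; rewrite ?inE// yk xk.
have -> : D = \bigcup_k fiber k.
  by apply/seteqP; split=> [x Dx|x [k _ []//]]; exists (code x).
rewrite !measure_bigcup; last 4 first.
- by move=> k _; have [->|[x ->]] := fiber1 k.
- exact/trivIset_setIl/trivIset_preimage1.
- by move=> k _; have [->|[x ->]] := fiber1 k.
- exact/trivIset_setIl/trivIset_preimage1.
apply: eq_eseriesr => k _; have [->|[x ->]] := fiber1 k; last exact: atoms.
by rewrite !measure0.
Qed.

Lemma eqm_countable_atoms mu nu D : (forall x : T, measurable [set x]) ->
  countable D -> mu D = 1%E ->
  (forall x, mu [set x] = nu [set x]) -> eqm mu nu.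
Proof.
move=> mT1 cD D1 atoms A mA; have mD := countable_measurable mT1 cD.
rewrite -(probability_setI1 mA mD D1).
have nuD : nu D = 1%E by rewrite -D1; apply/esym/measure_countable_atoms.
rewrite -[RHS](probability_setI1 mA mD nuD).
apply: measure_countable_atoms => //.
by apply: sub_countable cD; apply: subset_card_le => x [].
Qed.

Lemma ge0_ae_eq_le_integral (m : {measure set T -> \bar R}) (f g : T -> R) :
  measurable_fun setT f -> measurable_fun setT g ->
  (forall t, 0 <= f t <= g t) -> (\int[m]_t (f t)%:E < +oo)%E ->
  (\int[m]_t (g t)%:E <= \int[m]_t (f t)%:E)%E -> {ae m, forall t, f t = g t}.
Proof.
move=> mf mg fg f_fin gf.
have f0 t : (0 <= (f t)%:E)%E by rewrite lee_fin; have /andP[] := fg t.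
have gBf0 t : (0 <= (g t - f t)%:E)%E.
  by rewrite lee_fin subr_ge0; have /andP[] := fg t.
have mgBf : measurable_fun setT (fun t => (g t - f t)%:E).
  by apply/measurable_EFinP; exact: measurable_funB.
have gE : (\int[m]_t (g t)%:E =
    \int[m]_t (f t)%:E + \int[m]_t (g t - f t)%:E)%E.
  rewrite -ge0_integralD//; last exact/measurable_EFinP.
  by apply: eq_integral => t _; rewrite -EFinD addrC subrK.
have gBf_int0 : (\int[m]_t `|(g t - f t)%:E| = 0)%E.
  under eq_integral do rewrite gee0_abs//.
  have f_num : (\int[m]_t (f t)%:E)%E \is a fin_num.
    by rewrite ge0_fin_numE// integral_ge0.
  apply/eqP; rewrite eq_le integral_ge0// andbT -(leeD2lE _ _ f_num) -gE adde0.
  exact: gf.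
move/(ae_eq_integral_abs m measurableT mgBf): gBf_int0.
apply: filterS => t /(_ I) gBf0t.
by apply/esym/subr0_eq/EFin_inj.
Qed.

End Probability.

Lemma ae_prod d d' (T : measurableType d) (T' : measurableType d')
    (R : realType) (m : {measure set T -> \bar R})
    (m' : {sigma_finite_measure set T' -> \bar R}) (P : T * T' -> Prop) :
  {ae (m \x m')%E, forall z, P z} ->
  {ae m, forall x, {ae m', forall y, P (x, y)}}.
Proof.
move=> [N [mN N0 PN]].
have mNx := measurable_fun_xsection m' mN.
have : (\int[m]_x `|m' (xsection N x)| = 0)%E.
  by under eq_integral do rewrite gee0_abs//.
move/(ae_eq_integral_abs m measurableT mNx); apply: filterS => x /(_ I) Nx0.
exists (xsection N x); split => //; first exact: measurable_xsection.
by move=> y /= nP; rewrite /xsection/= inE; exact: PN.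
Qed.

Section DilationDifferenceIntegral.
Context d (T : measurableType d) (R : realType).
Variables (m : {measure set T -> \bar R}) (g : R -> T -> R).
Hypothesis ig : forall s, m.-integrable setT (EFin \o g s).

Lemma integrable_dildiff k t :
  m.-integrable setT (EFin \o (fun y => dildiff k (g ^~ y) t)).
Proof.
elim: k t => [|k IH] t /=; first exact: integrableD (ig t) (ig (- t)).
exact: integrableB (IH (2 * t)) (integrableZl measurableT (4 ^+ k) (IH t)).
Qed.

Lemma Rintegral_dildiff k t :
  (\int[m]_y dildiff k (g ^~ y) t)%R =
  dildiff k (fun s => (\int[m]_y g s y)%R) t.
Proof.
elim: k t => [|k IH] t /=; first exact: RintegralD.
have i2 := integrable_dildiff k (2 * t); have i1 := integrable_dildiff k t.
rewrite RintegralB//; last exact: integrableZl i1.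
by rewrite RintegralZl// !IH.
Qed.

End DilationDifferenceIntegral.

(** * Borel measures on a normed space *)

Section BorelSpace.
Variables (R : realType) (E : normedModType R).
Local Notation BE := (borel E).
Implicit Types (x y : E) (mu nu : probability BE R) (C : set E) (r : R).

Lemma open_borel (A : set E) : open A -> measurable (A : set BE).
Proof. exact: sub_sigma_algebra. Qed.

Lemma closed_borel C : closed C -> measurable (C : set BE).
Proof. by rewrite -openC => /open_borel/measurableC; rewrite setCK. Qed.

Lemma ball_borel x r : measurable (ball x r : set BE).
Proof. by apply: open_borel; exact: ball_open. Qed.

Lemma set1_closed x : closed [set x].
Proof.
apply: accessible_closed_set1; apply: hausdorff_accessible.
exact: norm_hausdorff.
Qed.

Lemma set1_borel x : measurable ([set x] : set BE).
Proof. by apply: closed_borel; exact: set1_closed. Qed.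

Lemma continuous_borel (f : E -> R) :
  continuous f -> measurable_fun setT (f : BE -> R).
Proof.
move=> /continuousP cf; apply: (measurability _ (RGenOpens.measurableE R)).
move=> _ [_ [a [b ->] <-]]; rewrite setTI; apply: open_borel; apply: cf.
exact: interval_open.
Qed.

Lemma continuous_borel_map (f : E -> E) :
  continuous f -> measurable_fun setT (f : BE -> BE).
Proof.
move=> /continuousP cf.
apply: (@measurability _ _ BE BE setT f (@open E) erefl).
by move=> _ [B oB <-]; rewrite setTI; apply: open_borel; exact: cf.
Qed.

Lemma measurable_distE_r x : measurable_fun setT (fun y : BE => distE x y).
Proof. exact: continuous_borel (@continuous_distE_r _ _ x). Qed.

Lemma eqm_closed mu nu : (forall C, closed C -> mu C = nu C) -> eqm mu nu.
Proof.
move=> mu_nu; apply: (@measure_unique _ _ BE (@open E) (fun=> setT)) => //.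
- by move=> A B oA oB; exact: openI.
- by move=> _; exact: openT.
- by rewrite bigcup_const//; exists 0%N.
- move=> A oA; have mAC : measurable (~` A : set BE).
    by apply: measurableC; exact: open_borel.
  have complE (m : probability BE R) : m A = (1 - m (~` A))%E :> \bar R.
    by rewrite -[in LHS](setCK A); exact: (probability_setC m mAC).
  apply: etrans (complE mu) (etrans _ (esym (complE nu))).
  by rewrite mu_nu//; exact: open_closedC.
- by move=> _; rewrite [ltLHS](@probability_setT _ _ _ mu) ltry.
Qed.

Definition enlarge C r : set E := \bigcup_(c in C) ball c r.

Lemma enlarge_borel C r : measurable (enlarge C r : set BE).
Proof. by apply: open_borel; apply: bigcup_open => c _; exact: ball_open. Qed.

Lemma enlargeD C r s : enlarge (enlarge C r) s `<=` enlarge C (r + s).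
Proof.
by move=> y [x [c Cc cx] xy]; exists c => //; exact: ball_triangle cx xy.
Qed.

Lemma enlarge_bigcap C : closed C -> \bigcap_n enlarge C n.+1%:R^-1 = C.
Proof.
move=> cC; apply/seteqP; split=> [y Cy|y Cy n _]; last first.
  by exists y => //; apply: ballxx; rewrite invr_gt0.
rewrite (closure_id C).1// => U /nbhs_ballP[r /= r0 yrU].
have [k _ /(_ _ (leqnn k)) kr] := near_infty_natSinv_lt (PosNum r0).
have [c Cc cy] := Cy k I; exists c; split => //; apply/yrU/ball_sym.
exact: le_ball (ltW kr) _ cy.
Qed.

Lemma closed_le_enlarge mu nu C : closed C ->
  (forall r, 0 < r -> (mu C <= nu (enlarge C r) + r%:E)%E) -> (mu C <= nu C)%E.
Proof.
move=> cC mu_nu; pose F (n : nat) : set BE := enlarge C n.+1%:R^-1.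
have nuF : (nu \o F) n @[n --> \oo] --> nu C.
  rewrite -[in X in _ --> X](enlarge_bigcap cC); apply: nonincreasing_cvg_mu.
  - rewrite (le_lt_trans (probability_le1 _ _)) ?ltry//.
    exact: enlarge_borel.
  - by move=> n; exact: enlarge_borel.
  - by rewrite enlarge_bigcap//; exact: closed_borel.
  - move=> m n mn; apply/subsetPset; apply: subset_bigcup => c _.
    by apply: le_ball; rewrite lef_pV2 ?posrE// ler_nat.
have r0 : (n.+1%:R^-1 : R)%:E @[n --> \oo] --> 0%:E.
  by apply: cvg_EFin; [exact: nearW|exact: cvg_harmonic].
have : ((nu \o F) n + (n.+1%:R^-1 : R)%:E)%E @[n --> \oo] --> nu C.
  by rewrite -[nu C]adde0; apply: cvgeD => //; rewrite fin_num_adde_defl.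
by apply: cvge_ge; apply: nearW => n; apply: mu_nu; rewrite invr_gt0.
Qed.

Definition measure_support mu : set E :=
  [set x | forall r, 0 < r -> mu (ball x r) <> 0%E].

Lemma support_sub_closed mu C : closed C -> {ae mu, forall x, C x} ->
  measure_support mu `<=` C.
Proof.
move=> cC muC x mux; rewrite (closure_id C).1// => U /nbhs_ballP[r /= r0 xrU].
apply: contrapT => CU; apply: (mux r r0).
apply/(negligibleP _ (ball_borel x r)); apply: negligibleS muC => y xy Cy.
by apply: CU; exists y; split => //; exact: xrU.
Qed.

Hypothesis sepE : separable_space E.

Lemma dense_sequence : exists e : nat -> E,
  forall x r, 0 < r -> exists n, ball x r (e n).
Proof.
have [D [/pfcard_geP[D0|[e]] dD]] := sepE.
  by move: dD; rewrite D0 => /dense0.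
exists e => x r r0.
have [||y [xy Dy]] := dD (ball x r).
- by exists x; exact: ballxx.
- exact: ball_open.
by have [n _ eny] := @surj _ _ _ _ e y Dy; exists n; rewrite eny.
Qed.

Lemma measurable_distE :
  measurable_fun setT (fun z : BE * BE => distE z.1 z.2).
Proof.
have [e e_dense] := dense_sequence.
apply: (measurability _ (RGenInftyO.measurableE R)).
move=> _ [_ [r ->] <-]; rewrite setTI.
pose s n (z : BE * BE) := distE (e n) z.1 + distE (e n) z.2.
have ms n : measurable_fun setT (s n).
  have me := measurable_distE_r (e n).
  by apply: measurable_funD; exact: measurableT_comp me _.
have -> : (fun z : BE * BE => distE z.1 z.2) @^-1` `]-oo, r[ =
    \bigcup_n (s n @^-1` `]-oo, r[).
  apply/seteqP; split=> -[x y]; rewrite /preimage/= in_itv/=; last first.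
    move=> [n _]; rewrite /= in_itv/= /s/=; apply: le_lt_trans.
    by rewrite (distEC (e n)) distE_triangle.
  move=> xyr; have gap0 : 0 < (r - distE x y) / 2.
    by rewrite divr_gt0// subr_gt0.
  have [n] := e_dense x _ gap0; rewrite ball_distE/= => xn.
  exists n => //=; rewrite in_itv/= /s/=.
  by have := distE_triangle x (e n) y; rewrite !(distEC (e n) x); lra.
apply: bigcupT_measurable => n; rewrite -[X in measurable X]setTI.
exact: ms.
Qed.

Lemma ae_support mu : {ae mu, forall x, measure_support mu x}.
Proof.
have [e e_dense] := dense_sequence.
pose B n k : set BE := ball (e n) k.+1%:R^-1.
pose null n k := if mu (B n k) == 0%E then B n k else set0.
have null_negl n k : mu.-negligible (null n k).
  rewrite /null; case: eqP => [B0|_]; last exact: negligible_set0.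
  by apply/negligibleP => //; exact: ball_borel.
have null_all := negligible_bigcup (fun n => negligible_bigcup (null_negl n)).
apply: negligibleS null_all => x /existsNP[r /not_implyP[r0 /contrapT x0]].
have r20 : 0 < r / 2 by rewrite divr_gt0.
have [k _ /(_ _ (leqnn k)) kr] := near_infty_natSinv_lt (PosNum r20).
have [|n xn] := e_dense x k.+1%:R^-1; first by rewrite invr_gt0.
exists n => //; exists k => //; rewrite /null ifT; first exact: ball_sym.
apply/eqP/negligibleP; first exact: ball_borel.
apply: negligibleS ((negligibleP _ (ball_borel x r)).2 x0) => y ny.
rewrite [r]splitr.
exact: ball_triangle (le_ball (ltW kr) xn) (le_ball (ltW kr) ny).
Qed.

Lemma countable_range_approx r : 0 < r -> exists f : E -> E,
  [/\ measurable_fun setT (f : BE -> BE), countable (range f) &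
      forall x, distE (f x) x <= r].
Proof.
move=> r0; have [e e_dense] := dense_sequence.
have near_e x : exists n, distE (e n) x < r.
  by have [n] := e_dense x r r0; rewrite ball_distE/= distEC; exists n.
pose k x := ex_minn (near_e x).
have kP x : distE (e (k x)) x < r by rewrite /k; case: ex_minnP.
pose B n : set BE := ball (e n) r.
have kE n : k @^-1` [set n] = seqDU B n.
  rewrite /seqDU -bigcup_mkord; apply/seteqP; split=> x.
    move=> <-; split=> [|[i /= ik]]; rewrite /B ball_distE//= => xi.
    move: ik; rewrite /k; case: ex_minnP => m _ /(_ i xi).
    by rewrite leqNgt => /negP.
  rewrite /B ball_distE => -[/= xn xB]; rewrite /k.
  case: ex_minnP => m xm /(_ n xn) mn; apply/eqP; rewrite eqn_leq mn leqNgt.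
  by apply/negP => mn'; apply: xB; exists m => //; rewrite ball_distE.
exists (e \o k); split.
- move=> _ A mA; rewrite setTI.
  have -> : (e \o k) @^-1` A = \bigcup_(n in e @^-1` A) k @^-1` [set n].
    apply/seteqP; split=> [x Ax|x [n /= An xn]]; first by exists (k x).
    by rewrite /preimage/= xn.
  apply: bigcup_measurable => n _; rewrite kE.
  by apply: seqDU_measurable => i; exact: ball_borel.
- have := sub_countable (card_image_le e (range k)) (countableP _).
  by rewrite image_comp; apply.
- by move=> x; apply: ltW; exact: kP.
Qed.

End BorelSpace.

(** * Wasserstein distance *)

Lemma ler_powR2r (R : realType) (p a b : R) : 0 < p -> 0 <= a -> 0 <= b ->
  (a `^ p <= b `^ p) = (a <= b).
Proof. by move=> p0 a0 b0; apply: (le_mono_in (gt0_ltr_powR p0)). Qed.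

Lemma powRD_le (R : realType) (p a b : R) : 1 <= p -> 0 <= a -> 0 <= b ->
  (a + b) `^ p <= 2 `^ (p - 1) * (a `^ p + b `^ p).
Proof.
move=> p1 a0 b0.
have : (2^-1 * (2 * a) + 2^-1 * (2 * b)) `^ p <=
    2^-1 * (2 * a) `^ p + 2^-1 * (2 * b) `^ p.
  rewrite {2 4}(_ : 2^-1 = 1 - 2^-1); last by lra.
  by apply: (convex_powR p1 (Itv01 _ _)) => //=;
    rewrite ?inE/= ?in_itv/= ?mulr_ge0// ?invr_ge0// invf_le1 ?ler1n.
rewrite !mulrA mulVf// !mul1r => /le_trans; apply.
rewrite !powRM// !mulrA -powR_inv1// -powRD ?pnatr_eq0 ?implybT//.
by rewrite (addrC _ p) -mulrDr.
Qed.

Lemma addr_powR_le_double (R : realType) (p a b : R) : 0 < p -> 0 <= a <= b ->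
  2 `^ (p - 1) * (a `^ p + b `^ p) <= (2 * b) `^ p.
Proof.
move=> p0 /andP[a0 ab]; have b0 := le_trans a0 ab.
rewrite powRM// -(@mulr_powRB1 _ 2 p)// [2 * _]mulrC -mulrA.
by rewrite ler_wpM2l ?powR_ge0// mulr_natl mulr2n lerD2r ler_powR2r.
Qed.

Section Wasserstein.
Variables (R : realType) (E : normedModType R).
Hypothesis sepE : separable_space E.
Variable p : R.
Hypothesis p1 : 1 <= p.
Local Notation BE := (borel E).
Local Notation W := (wasserstein p).
Implicit Types (mu nu eta : probability BE R).
Implicit Types (pi : probability (BE * BE)%type R) (x y z a b : E).

Let p0 : 0 < p. Proof. exact: lt_le_trans p1. Qed.

Definition distp x y : R := distE x y `^ p.

Lemma distp_ge0 x y : (0 <= (distp x y)%:E)%E.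
Proof. by rewrite lee_fin powR_ge0. Qed.

Lemma distpC x y : distp x y = distp y x.
Proof. by rewrite /distp distEC. Qed.

Lemma distp_eq0 x y : distp x y = 0 -> x = y.
Proof. by move/powR_eq0_eq0/distE_eq0. Qed.

Lemma distp_triangle y x z :
  distp x z <= 2 `^ (p - 1) * (distp x y + distp y z).
Proof.
rewrite (le_trans _ (powRD_le p1 (distE_ge0 _ _) (distE_ge0 _ _)))//.
by rewrite ler_powR2r ?addr_ge0 ?distE_ge0 ?distE_triangle.
Qed.

Lemma distp_triangle_eq y x z :
  distp x z = 2 `^ (p - 1) * (distp x y + distp y z) -> between x y z.
Proof.
move=> xyz; apply/eqP; rewrite eq_le distE_triangle/=.
rewrite -(ler_powR2r p0) ?addr_ge0 ?distE_ge0// [leRHS]xyz.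
by rewrite powRD_le ?distE_ge0.
Qed.

Lemma measurable_distp d (T : measurableType d) (f g : T -> BE) :
  measurable_fun setT f -> measurable_fun setT g ->
  measurable_fun setT (fun t => distp (f t) (g t)).
Proof.
move=> mf mg; apply: (measurableT_comp (measurable_powR p)).
exact: (measurableT_comp (measurable_distE sepE) (measurable_fun_pair mf mg)).
Qed.

Lemma measurable_EFin_distp d (T : measurableType d) (f g : T -> BE) :
  measurable_fun setT f -> measurable_fun setT g ->
  measurable_fun setT (fun t => (distp (f t) (g t))%:E).
Proof. by move=> mf mg; apply/measurable_EFinP; exact: measurable_distp. Qed.

Lemma integral_distp_triangle d (T : measurableType d)
    (m : {measure set T -> \bar R}) (f g h : T -> BE) :
  measurable_fun setT f -> measurable_fun setT g -> measurable_fun setT h ->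
  (\int[m]_t (distp (f t) (h t))%:E <=
    (2 `^ (p - 1))%:E * (\int[m]_t (distp (f t) (g t))%:E +
                         \int[m]_t (distp (g t) (h t))%:E))%E.
Proof.
move=> mf mg mh; have mfg := measurable_EFin_distp mf mg.
have mgh := measurable_EFin_distp mg mh.
have mD := emeasurable_funD mfg mgh.
rewrite -ge0_integralD//; do 1?[by move=> t _; exact: distp_ge0].
rewrite -ge0_integralZl//; do 1?[by rewrite lee_fin powR_ge0];
  last by move=> t _; rewrite adde_ge0 ?distp_ge0.
apply: ge0_le_integral => //.
- by move=> t _; exact: distp_ge0.
- exact: measurable_EFin_distp.
- exact: measurable_funeM.
- by move=> t _; rewrite -EFinD -EFinM lee_fin distp_triangle.
Qed.

Let quasi_triangle_lty (u v : \bar R) :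
  (u < +oo -> v < +oo -> (2 `^ (p - 1))%:E * (u + v) < +oo)%E.
Proof.
move=> u_fin v_fin; apply: lte_mul_pinfty; rewrite ?lee_fin ?powR_ge0//.
exact: lte_add_pinfty.
Qed.

Definition potential mu x : \bar R := (\int[mu]_y (distp x y)%:E)%E.

Let m_id : measurable_fun setT (@id BE). Proof. exact: measurable_id. Qed.

Let m_cst d (T : measurableType d) x :
  measurable_fun setT (fun _ : T => x : BE).
Proof. exact: measurable_cst. Qed.

Lemma measurable_EFin_distp_r x :
  measurable_fun setT (fun y : BE => (distp x y)%:E).
Proof. exact: (measurable_EFin_distp (m_cst x) m_id). Qed.

Lemma potential_ge0 mu x : (0 <= potential mu x)%E.
Proof. by apply: integral_ge0 => y _; exact: distp_ge0. Qed.

Lemma potential_law d (T : measurableType d) (m : probability T R) (f : T -> BE)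
    (mf : measurable_fun setT f) x :
  potential (law m mf) x = (\int[m]_t (distp x (f t))%:E)%E.
Proof.
exact: (ge0_integral_law m mf (measurable_EFin_distp_r x) (distp_ge0 x)).
Qed.

Lemma potential_lty mu x y : (potential mu x < +oo -> potential mu y < +oo)%E.
Proof.
move=> mux.
apply: le_lt_trans (integral_distp_triangle mu (m_cst y) (m_cst x) m_id) _.
by apply: quasi_triangle_lty mux; rewrite integral_cst_probability ltry.
Qed.

Lemma Wp_potential mu x : Wp p mu <-> (potential mu x < +oo)%E.
Proof.
have -> : Wp p mu = (potential mu 0%R < +oo)%E :> Prop.
  rewrite /Wp /potential /=; under [in RHS]eq_integral do
    rewrite /distp /distE sub0r normrN.
  by [].
by split; exact: potential_lty.
Qed.

Lemma potential_fin_num mu x : Wp p mu -> potential mu x \is a fin_num.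
Proof. by move=> /(Wp_potential mu x); rewrite ge0_fin_numE ?potential_ge0. Qed.

Lemma Wp_eqm mu nu : eqm mu nu -> Wp p mu -> Wp p nu.
Proof. by move=> mn; rewrite /Wp /= (eqm_integral _ mn). Qed.

Lemma integrable_distp mu x : Wp p mu ->
  mu.-integrable setT (EFin \o (fun y : BE => distp x y)).
Proof.
move=> /(Wp_potential mu x) mux; apply/integrableP; split.
  exact: measurable_EFin_distp_r.
rewrite (eq_integral (fun y : BE => (distp x y)%:E))// => y _.
by rewrite gee0_abs ?distp_ge0.
Qed.

Lemma coupling_law_fst mu nu pi :
  coupling mu nu pi -> eqm (law pi measurable_fst) mu.
Proof. by move=> cpl A mA; have [<- _] := cpl A mA; rewrite setXT. Qed.

Lemma coupling_law_snd mu nu pi :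
  coupling mu nu pi -> eqm (law pi measurable_snd) nu.
Proof. by move=> cpl A mA; have [_ <-] := cpl A mA; rewrite setTX. Qed.

Lemma coupling_law d (T : measurableType d) (m : probability T R)
    (f g : T -> BE) (mf : measurable_fun setT f) (mg : measurable_fun setT g) :
  coupling (law m mf) (law m mg) (law m (measurable_fun_pair mf mg)).
Proof. by move=> A mA; rewrite setXT setTX. Qed.

Lemma coupling_swap mu nu pi : coupling mu nu pi ->
  coupling nu mu (law pi (measurable_fun_pair measurable_snd measurable_fst)).
Proof.
move=> cpl A mA; rewrite setXT setTX; split.
  exact: coupling_law_snd cpl A mA.
exact: coupling_law_fst cpl A mA.
Qed.

Lemma coupling_prod mu nu : coupling mu nu (mu \x nu)%E.
Proof.
move=> A mA; split.
  apply: etrans (product_measure1E mu nu mA measurableT) _.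
  by rewrite [X in (_ * X)%E](@probability_setT _ _ _ nu) mule1.
apply: etrans (product_measure1E mu nu measurableT mA) _.
by rewrite [X in (X * _)%E](@probability_setT _ _ _ mu) mul1e.
Qed.

Lemma coupling_potential_fst mu nu pi x : coupling mu nu pi ->
  (\int[pi]_t (distp t.1 x)%:E = potential mu x)%E.
Proof.
move=> /coupling_law_fst/eqm_integral muE.
rewrite /potential -muE -/(potential _ x) potential_law.
by under eq_integral do rewrite distpC.
Qed.

Lemma coupling_potential_snd mu nu pi x : coupling mu nu pi ->
  (\int[pi]_t (distp x t.2)%:E = potential nu x)%E.
Proof.
move=> /coupling_law_snd/eqm_integral nuE.
by rewrite /potential -nuE -/(potential _ x) potential_law.
Qed.

Lemma transport_cost_ge0 pi : (0 <= transport_cost p pi)%E.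
Proof. by apply: integral_ge0 => t _; exact: distp_ge0. Qed.

Lemma transport_cost_law d (T : measurableType d) (m : probability T R)
    (f g : T -> BE) (mf : measurable_fun setT f) (mg : measurable_fun setT g) :
  transport_cost p (law m (measurable_fun_pair mf mg)) =
  (\int[m]_t (distp (f t) (g t))%:E)%E.
Proof.
exact: (ge0_integral_law m (measurable_fun_pair mf mg)
  (measurable_EFin_distp measurable_fst measurable_snd) (fun=> distp_ge0 _ _)).
Qed.

Lemma transport_cost_le mu nu pi x : coupling mu nu pi ->
  (transport_cost p pi <=
    (2 `^ (p - 1))%:E * (potential mu x + potential nu x))%E.
Proof.
move=> cpl.
rewrite -(coupling_potential_fst x cpl) -(coupling_potential_snd x cpl).
exact: integral_distp_triangle.
Qed.

Lemma transport_cost_lty mu nu pi : Wp p mu -> Wp p nu -> coupling mu nu pi ->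
  (transport_cost p pi < +oo)%E.
Proof.
move=> /(Wp_potential _ 0) Wmu /(Wp_potential _ 0) Wnu cpl.
exact: le_lt_trans (transport_cost_le 0 cpl) (quasi_triangle_lty Wmu Wnu).
Qed.

Lemma coupling_between mu nu pi y : coupling mu nu pi ->
  (transport_cost p pi < +oo)%E ->
  ((2 `^ (p - 1))%:E * (potential mu y + potential nu y) <=
    transport_cost p pi)%E ->
  {ae pi, forall t, between t.1 y t.2}.
Proof.
move=> cpl cost_fin tight.
pose bound (t : BE * BE) := 2 `^ (p - 1) * (distp t.1 y + distp y t.2).
have m1y := measurable_distp measurable_fst (@m_cst _ (BE * BE)%type y).
have my2 := measurable_distp (@m_cst _ (BE * BE)%type y) measurable_snd.
have mbound : measurable_fun setT bound.
  apply: measurable_funM; first exact: measurable_cst.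
  exact: measurable_funD m1y my2.
have distp_bound (t : BE * BE) : 0 <= distp t.1 t.2 <= bound t.
  by rewrite powR_ge0 distp_triangle.
have boundE : (\int[pi]_t (bound t)%:E =
    (2 `^ (p - 1))%:E * (potential mu y + potential nu y))%E.
  rewrite -(coupling_potential_fst y cpl) -(coupling_potential_snd y cpl).
  have [/measurable_EFinP m1y' /measurable_EFinP my2'] := (m1y, my2).
  rewrite -ge0_integralD => [|//|t _|//|t _|//]; do 1?exact: distp_ge0.
  rewrite -ge0_integralZl => [//|//||t _|]; last by rewrite lee_fin powR_ge0.
    exact: emeasurable_funD.
  by rewrite adde_ge0 ?distp_ge0.
rewrite -boundE in tight.
have := ge0_ae_eq_le_integral (measurable_distp measurable_fst measurable_snd)
  mbound distp_bound cost_fin tight.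
by apply: filterS => t; exact: distp_triangle_eq.
Qed.

Definition optimal_cost mu nu : \bar R :=
  ereal_inf [set transport_cost p pi | pi in [set pi | coupling mu nu pi]].

Lemma optimal_cost_ge0 mu nu : (0 <= optimal_cost mu nu)%E.
Proof.
by apply: le_ereal_inf_tmp => _ [pi _ <-]; exact: transport_cost_ge0.
Qed.

Lemma optimal_cost_le mu nu pi : coupling mu nu pi ->
  (optimal_cost mu nu <= transport_cost p pi)%E.
Proof. by move=> cpl; apply: ereal_inf_lbound; exists pi. Qed.

Lemma optimal_cost_fin_num mu nu : Wp p mu -> Wp p nu ->
  optimal_cost mu nu \is a fin_num.
Proof.
move=> Wmu Wnu; have cpl := coupling_prod mu nu.
rewrite ge0_fin_numE ?optimal_cost_ge0//.
exact: le_lt_trans (optimal_cost_le cpl) (transport_cost_lty Wmu Wnu cpl).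
Qed.

Lemma optimal_cost_swap_le mu nu : (optimal_cost mu nu <= optimal_cost nu mu)%E.
Proof.
apply: le_ereal_inf_tmp => _ [pi /= cpl <-].
apply: le_trans (optimal_cost_le (coupling_swap cpl)) _.
rewrite transport_cost_law; under eq_integral do rewrite distpC.
exact: lexx.
Qed.

Lemma optimal_cost_eqm_le mu nu nu' : eqm nu nu' ->
  (optimal_cost mu nu' <= optimal_cost mu nu)%E.
Proof.
move=> nn'; apply: le_ereal_inf_tmp => _ [pi /= cpl <-].
by apply: optimal_cost_le => A mA; rewrite -nn'//; exact: cpl.
Qed.

Lemma wasserstein_ge0 mu nu : 0 <= W mu nu.
Proof. exact: powR_ge0. Qed.

Lemma fine_optimal_cost mu nu : fine (optimal_cost mu nu) = W mu nu `^ p.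
Proof.
by rewrite -powRrM mulVf ?gt_eqF// powRr1// fine_ge0// optimal_cost_ge0.
Qed.

Lemma wassersteinC mu nu : W mu nu = W nu mu.
Proof.
congr (fine _ `^ _); apply: le_anti.
by rewrite !optimal_cost_swap_le.
Qed.

Lemma eqm_wasserstein mu nu nu' : eqm nu nu' -> W mu nu = W mu nu'.
Proof.
move=> nn'; congr (fine _ `^ _); apply: le_anti.
by rewrite !optimal_cost_eqm_le//; exact: eqm_sym.
Qed.

Lemma wasserstein_powR mu nu : Wp p mu -> Wp p nu ->
  (W mu nu `^ p)%:E = optimal_cost mu nu.
Proof.
by move=> Wmu Wnu; rewrite -fine_optimal_cost fineK ?optimal_cost_fin_num.
Qed.

Lemma wasserstein_powR_le mu nu pi : coupling mu nu pi ->
  ((W mu nu `^ p)%:E <= transport_cost p pi)%E.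
Proof.
move=> /optimal_cost_le; apply: le_trans; rewrite -fine_optimal_cost.
by case: (optimal_cost mu nu) (optimal_cost_ge0 mu nu) => //= _; exact: leey.
Qed.

Lemma wasserstein_law_powR_le d (T : measurableType d) (m : probability T R)
    (f g : T -> BE) (mf : measurable_fun setT f) (mg : measurable_fun setT g) :
  ((W (law m mf) (law m mg) `^ p)%:E <= \int[m]_t (distp (f t) (g t))%:E)%E.
Proof.
rewrite -transport_cost_law; apply: wasserstein_powR_le; exact: coupling_law.
Qed.

Section UniformlyClose.
Context d (T : measurableType d) (m : probability T R) (f g : T -> BE).
Hypotheses (mf : measurable_fun setT f) (mg : measurable_fun setT g).
Variable r : R.
Hypotheses (r0 : 0 <= r) (fg : forall t, distE (f t) (g t) <= r).

Let integral_distp_le_cst : (\int[m]_t (distp (f t) (g t))%:E <= (r `^ p)%:E)%E.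
Proof.
rewrite -(integral_cst_probability m (r `^ p)%:E); apply: ge0_le_integral => //.
- by move=> t _; exact: distp_ge0.
- exact: measurable_EFin_distp.
- by move=> t _; rewrite lee_fin ler_powR2r ?distE_ge0.
Qed.

Lemma wasserstein_law_le : W (law m mf) (law m mg) <= r.
Proof.
rewrite -(ler_powR2r p0) ?wasserstein_ge0// -lee_fin.
exact: le_trans (wasserstein_law_powR_le m mf mg) integral_distp_le_cst.
Qed.

Lemma Wp_law_close : Wp p (law m mg) -> Wp p (law m mf).
Proof.
move=> /(Wp_potential _ 0); rewrite potential_law => Wg.
apply/(Wp_potential _ 0); rewrite potential_law.
under eq_integral do rewrite distpC.
apply: le_lt_trans (integral_distp_triangle m mf mg (m_cst 0)) _.
apply: quasi_triangle_lty.
  exact: le_lt_trans integral_distp_le_cst (ltry _).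
by under eq_integral do rewrite distpC.
Qed.

End UniformlyClose.

(** * Metric characterisation of Dirac masses *)

Definition is_dirac mu x := mu [set x] = 1%E.

Lemma is_dirac_ae mu x : is_dirac mu x <-> {ae mu, forall y, y = x}.
Proof. exact: probability1_ae (set1_borel x). Qed.

Lemma is_dirac_dirac x : is_dirac \d_(x : BE) x.
Proof. by apply: etrans (diracE _ _ _) _; rewrite mem_set. Qed.

Lemma potential_dirac mu x y : is_dirac mu x -> potential mu y = (distp y x)%:E.
Proof.
move=> /is_dirac_ae mux; rewrite -[RHS](integral_cst_probability mu).
apply: ge0_ae_eq_integral => //; do 1?[by move=> z _; exact: distp_ge0].
  exact: measurable_EFin_distp_r.
by apply: ae_imply mux => z ->.
Qed.

Lemma Wp_dirac mu x : is_dirac mu x -> Wp p mu.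
Proof.
by move=> mux; apply/(Wp_potential _ x); rewrite (potential_dirac _ mux) ltry.
Qed.

Lemma potential_eq0_dirac mu x : potential mu x = 0%E -> is_dirac mu x.
Proof.
move=> mux0; apply/is_dirac_ae.
have : (\int[mu]_y `|(distp x y)%:E| = 0)%E.
  by under eq_integral do rewrite gee0_abs ?distp_ge0//.
move/(ae_eq_integral_abs mu measurableT (measurable_EFin_distp_r x)).
apply: ae_imply => y /(_ I) xy0.
by apply/esym/distp_eq0/EFin_inj.
Qed.

Lemma transport_cost_dirac nu mu pi x : is_dirac mu x -> coupling nu mu pi ->
  transport_cost p pi = potential nu x.
Proof.
move=> mux cpl; rewrite -(coupling_potential_fst x cpl).
have mS : measurable ([set: BE] `*` [set x] : set (BE * BE)).
  by apply: measurableX => //; exact: set1_borel.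
have piS : {ae pi, forall t, ([set: BE] `*` [set x]) t}.
  by apply/(probability1_ae _ mS); have [_ ->] := cpl _ (set1_borel x).
apply: ge0_ae_eq_integral => //; do 1?[by move=> t _; exact: distp_ge0].
- exact: measurable_EFin_distp.
- exact: (measurable_EFin_distp measurable_fst (m_cst x)).
- by apply: ae_imply piS => -[s t] [_ /= ->].
Qed.

Lemma wasserstein_dirac nu mu x : Wp p nu -> is_dirac mu x ->
  (W nu mu `^ p)%:E = potential nu x.
Proof.
move=> Wnu mux; rewrite (wasserstein_powR Wnu (Wp_dirac mux)) -[RHS]ereal_inf1.
congr ereal_inf; apply/seteqP; split=> [_ [pi cpl <-]|_ ->].
  exact: transport_cost_dirac mux cpl.
have cpl := coupling_prod nu mu; exists (nu \x mu)%E; first exact: cpl.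
exact: transport_cost_dirac mux cpl.
Qed.

Lemma eq_wasserstein_dirac mu eta nu x : Wp p mu -> is_dirac eta x ->
  is_dirac nu x -> W eta mu = W nu mu.
Proof.
move=> Wmu etax nux; rewrite !(wassersteinC _ mu).
apply: (powR_injective p0); do 1?exact: wasserstein_ge0.
apply: EFin_inj.
exact: etrans (wasserstein_dirac Wmu etax) (esym (wasserstein_dirac Wmu nux)).
Qed.

Lemma wasserstein_diracs mu nu x y : is_dirac mu x -> is_dirac nu y ->
  W mu nu = distE x y.
Proof.
move=> mux nuy; apply: (powR_injective p0).
- exact: wasserstein_ge0.
- exact: distE_ge0.
apply: EFin_inj; rewrite (wasserstein_dirac (Wp_dirac mux) nuy).
by rewrite (potential_dirac _ mux) distpC.
Qed.

Definition extends_geodesics mu := forall nu, Wp p nu ->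
  exists2 eta, Wp p eta & 2 * W nu mu <= W eta mu /\ W eta nu <= W nu mu.

(* The law of [2 y - x] under [nu]. *)
Lemma doubling_exists nu x : Wp p nu -> exists eta, [/\ Wp p eta,
  potential eta x = ((2 `^ p)%:E * potential nu x)%E &
  ((W eta nu `^ p)%:E <= potential nu x)%E].
Proof.
move=> Wnu; pose dilate y : E := (2 : R) *: y - x.
have mdil : measurable_fun setT (dilate : BE -> BE).
  apply: continuous_borel_map => y; apply: cvgB; last exact: cvg_cst.
  by apply: cvgZr; exact: cvg_id.
have distp_dil y : distp x (dilate y) = 2 `^ p * distp x y.
  have dilE : x - dilate y = 2 *: (x - y).
    by rewrite /dilate opprB addrA scalerBr !scaler_nat !mulr2n.
  by rewrite /distp /distE dilE normrZ ger0_norm// powRM.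
have etaE : potential (law nu mdil) x = ((2 `^ p)%:E * potential nu x)%E.
  rewrite potential_law; under eq_integral do rewrite distp_dil EFinM.
  rewrite ge0_integralZl ?lee_fin ?powR_ge0//.
    exact: measurable_EFin_distp_r.
  by move=> y _; exact: distp_ge0.
exists (law nu mdil); split; [|exact: etaE|].
  apply/(Wp_potential _ x); rewrite etaE.
  by rewrite -(fineK (potential_fin_num x Wnu)) ltry.
have nuE : eqm (law nu m_id) nu by [].
rewrite -(eqm_wasserstein _ nuE).
apply: le_trans (wasserstein_law_powR_le nu mdil m_id) _.
rewrite le_eqVlt; apply/orP; left; apply/eqP; apply: eq_integral => y _.
by rewrite /distp /distE /dilate scaler_nat mulr2n addrAC addrK distrC.
Qed.

Lemma dirac_extends_geodesics mu x : is_dirac mu x -> extends_geodesics mu.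
Proof.
move=> mux nu Wnu; have [eta [Weta]] := doubling_exists x Wnu.
rewrite -(wasserstein_dirac Weta mux) -(wasserstein_dirac Wnu mux).
rewrite -EFinM lee_fin => -[etaE] eta_nu; exists eta; first exact: Weta.
split=> [{eta_nu}|]; rewrite -(ler_powR2r p0) ?mulr_ge0 ?wasserstein_ge0//.
by rewrite etaE powRM ?wasserstein_ge0.
Qed.

Lemma support_dirac mu :
  (forall a b, measure_support mu a -> measure_support mu b -> a = b) ->
  exists x, is_dirac mu x.
Proof.
move=> supp1; have supp := ae_support sepE mu.
have [x mux] := ae_ex supp.
exists x; apply/is_dirac_ae; apply: ae_imply supp => y muy; exact: supp1.
Qed.

Lemma between_closed z y : closed [set x | between z y x].
Proof.
pose gap x := distE z x - distE y x.
rewrite (_ : [set x | _] = gap @^-1` [set distE z y]).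
  apply: preimage_closed; last exact: set1_closed.
  by move=> x _; apply: cvgB; exact: continuous_distE_r.
apply/seteqP; split=> x; rewrite /between /gap /preimage /=.
  by move=> ->; rewrite addrK.
by move=> <-; rewrite subrK.
Qed.

(* The hypotheses make the product coupling of [eta] and [mu] optimal, with the
   extremal cost [2^(p-1) (potential eta y + potential mu y)]. *)
Lemma overshoot_between eta mu nu y : Wp p eta -> Wp p mu -> is_dirac nu y ->
  2 * W nu mu <= W eta mu -> W eta nu <= W nu mu ->
  {ae eta, forall z, {ae mu, forall x, between z y x}}.
Proof.
move=> Weta Wmu nuy far near; have cpl := coupling_prod eta mu.
suff prod_btw : {ae (eta \x mu)%E, forall t : BE * BE, between t.1 y t.2}.
  exact: (ae_prod prod_btw).
apply: (coupling_between cpl (transport_cost_lty Weta Wmu cpl)).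
apply: le_trans (wasserstein_powR_le cpl).
rewrite -(wasserstein_dirac Weta nuy) -(wasserstein_dirac Wmu nuy).
rewrite -EFinD -EFinM lee_fin (wassersteinC mu).
apply: le_trans (addr_powR_le_double p0 _) _.
  by rewrite wasserstein_ge0 near.
by rewrite ler_powR2r ?mulr_ge0 ?wasserstein_ge0.
Qed.

Lemma is_dirac_or_ae mu y (P : E -> Prop) : {ae mu, forall z, P z} ->
  is_dirac mu y \/ exists2 z, P z & z <> y.
Proof.
move=> muP; have [|ndir] := pselect (exists2 z, P z & z <> y); [by right|left].
apply/is_dirac_ae; apply: ae_imply muP => z Pz.
by apply: contrapT => zy; apply: ndir; exists z.
Qed.

Lemma extends_geodesics_dirac (ip : E -> E -> R) mu :
  inner_product_inducing_norm ip -> Wp p mu -> extends_geodesics mu ->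
  exists x, is_dirac mu x.
Proof.
move=> ipN Wmu mu_ext; apply: support_dirac => a b mua mub.
pose y := midpoint a b.
have [nu nuy] : exists nu, is_dirac nu y.
  by exists \d_(y : BE); exact: is_dirac_dirac.
have [eta Weta [far near]] := mu_ext nu (Wp_dirac nuy).
have btw := overshoot_between Weta Wmu nuy far near.
have supp_btw z : {ae mu, forall x, between z y x} ->
    forall x, measure_support mu x -> between z y x.
  by move=> ?; apply: support_sub_closed => //; exact: between_closed.
have [eta_y|[z /supp_btw zy zNy]] := is_dirac_or_ae y btw; last first.
  by have [] := between_midpoint ipN (zy a mua) (zy b mub).
have W0 : W nu mu = 0.
  apply/eqP; rewrite eq_le wasserstein_ge0 andbT; move: far.
  by rewrite (eq_wasserstein_dirac Wmu eta_y nuy) mulr_natl mulr2n gerDl.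
have /is_dirac_ae mu_y : is_dirac mu y.
  apply: potential_eq0_dirac; rewrite -(wasserstein_dirac Wmu nuy).
  by rewrite wassersteinC W0 powR0 ?gt_eqF.
have supp_y := support_sub_closed (@set1_closed _ _ y) mu_y.
by rewrite (supp_y a mua) (supp_y b mub).
Qed.

(** * Recovering atoms from the potential *)

Section Atoms.
Variable ip : E -> E -> R.
Hypothesis ipN : inner_product_inducing_norm ip.
Variables (n : nat) (e : E).
Hypotheses (pn : p + 1 <= n%:R) (e1 : `|e| = 1).
Local Notation kernel := (dilkernel p n e).

Lemma dilkernel_distp c x y : 0 < c -> kernel (c *: (x - y)) =
  dildiff n (fun s => c `^ p * distp (x + (s / c) *: e) y) 1.
Proof.
move=> c0; apply: eq_dildiff => s; rewrite /distp /distE -powRM ?(ltW c0)//.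
rewrite -[X in X * _](ger0_norm (ltW c0)) -normrZ; congr (`|_| `^ p).
by rewrite [x + _ - y]addrAC [RHS]scalerDr scalerA mulrCA divff ?mulr1 ?gt_eqF.
Qed.

Lemma integrable_scaled_distp mu c x s : Wp p mu ->
  mu.-integrable setT (EFin \o (fun y : BE => c * distp (x + s *: e) y)).
Proof.
move=> Wmu.
exact: (integrableZl measurableT c (integrable_distp (x + s *: e) Wmu)).
Qed.

Lemma integrable_dilkernel mu c x : 0 < c -> Wp p mu ->
  mu.-integrable setT (EFin \o (fun y : BE => kernel (c *: (x - y)))).
Proof.
move=> c0 Wmu; rewrite (_ : _ \o _ = EFin \o (fun y : BE =>
    dildiff n (fun s => c `^ p * distp (x + (s / c) *: e) y) 1)).
  by apply: integrable_dildiff => s; exact: integrable_scaled_distp.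
by apply/funext => y /=; rewrite dilkernel_distp.
Qed.

Lemma integral_dilkernel mu c x : 0 < c -> Wp p mu ->
  (\int[mu]_y (kernel (c *: (x - y)))%:E = (dildiff n
    (fun s => c `^ p * fine (potential mu (x + (s / c) *: e))) 1)%:E)%E.
Proof.
move=> c0 Wmu; have ik := integrable_dilkernel x c0 Wmu.
rewrite -[LHS](fineK (integrable_fin_num measurableT ik)); congr EFin.
transitivity (\int[mu]_y kernel (c *: (x - y)))%R; first by [].
under eq_Rintegral do rewrite (dilkernel_distp _ _ c0).
rewrite (Rintegral_dildiff
  (g := fun s (y : BE) => c `^ p * distp (x + (s / c) *: e) y)).
  by apply: eq_dildiff => s; rewrite RintegralZl//; exact: integrable_distp.
by move=> s; exact: integrable_scaled_distp.
Qed.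

Lemma integral_dilkernel_cvg mu x : Wp p mu ->
  (fun m : nat => \int[mu]_y (kernel (m.+1%:R *: (x - y)))%:E)%E @ \oo -->
  ((kernel 0)%:E * mu [set x])%E.
Proof.
move=> Wmu; have mx := set1_borel x.
have [C boundC] := dilkernel_bounded ipN (ltW p0) pn e1.
pose limit (y : BE) := kernel 0 * \1_[set x] y.
have limitE : (\int[mu]_y (limit y)%:E = (kernel 0)%:E * mu [set x])%E.
  under eq_integral do rewrite EFinM.
  by rewrite integralZl ?integral_indic ?setIT//; exact: integrable_indic.
have kernel_cvg (y : BE) : kernel (m.+1%:R *: (x - y)) @[m --> \oo] --> limit y.
  rewrite /limit indicE; have [->|yx] := eqVneq (y : E) x.
    rewrite mem_set// mulr1 subrr.
    by under eq_fun do rewrite scaler0; exact: cvg_cst.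
  rewrite memNset ?mulr0 => [|/= yxE]; last by rewrite yxE eqxx in yx.
  by apply: (dilkernel_cvg0 ipN (ltW p0) pn e1); rewrite subr_eq0 eq_sym.
have ik (m : nat) := integrable_dilkernel x (ltr0Sn R m) Wmu.
rewrite -limitE.
apply: (@dominated_cvg _ _ _ mu setT measurableT _ _ (cst C%:E)).
- by move=> m; exact: measurable_int (ik m).
- by move=> y _; apply: cvg_EFin; [exact: nearW|exact: kernel_cvg].
- by [].
- exact: finite_measure_integrable_cst.
- by move=> m y _; rewrite abse_EFin lee_fin.
Qed.

End Atoms.

Lemma eq_potential_atoms (ip : E -> E -> R) mu nu :
  inner_product_inducing_norm ip -> (~ exists k : nat, p = (2 * k)%:R) ->
  Wp p mu -> Wp p nu -> (forall x, potential mu x = potential nu x) ->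
  forall x, mu [set x] = nu [set x].
Proof.
move=> ipN peven Wmu Wnu mu_nu x.
have [[v v0]|E0] := pselect (exists v : E, v != 0); last first.
  have -> : [set x] = [set: BE].
    apply/seteqP; split=> // y _; have all0 (z : E) : z = 0.
      by apply: contrapT => /eqP z0; apply: E0; exists z.
    by rewrite (all0 x) (all0 y).
  rewrite [LHS](@probability_setT _ _ _ mu).
  by rewrite [RHS](@probability_setT _ _ _ nu).
have [n pn] : exists n : nat, p + 1 <= n%:R.
  by exists (Num.truncn (p + 1)).+1; apply/ltW/truncnS_gt.
have e1 := normfZV v0; set e := _ *: v in e1.
have mu_cvg := integral_dilkernel_cvg ipN pn e1 (x := x) Wmu.
have nu_cvg := integral_dilkernel_cvg ipN pn e1 (x := x) Wnu.
have same_int (m : nat) :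
    (\int[mu]_y (dilkernel p n e (m.+1%:R *: (x - y)))%:E =
    \int[nu]_y (dilkernel p n e (m.+1%:R *: (x - y)))%:E)%E.
  rewrite !integral_dilkernel//; congr EFin; apply: eq_dildiff => s.
  by rewrite mu_nu.
have kernel0 := dilkernel0_neq0 n e1 peven.
move: mu_cvg; under eq_fun do rewrite same_int.
move/(cvg_unique (@ereal_hausdorff R) nu_cvg).
move/(congr1 (mule (dilkernel p n e 0)^-1%:E)).
by rewrite !muleA -EFinM mulVf// !mul1e.
Qed.

(** * Separation of measures *)

Section Enlargement.
Implicit Types (C : set E) (r : R).

Definition far_pairs r : set (BE * BE) := [set t | r <= distE t.1 t.2].

Lemma measurable_far_pairs r : measurable (far_pairs r).
Proof.
rewrite (_ : far_pairs r =
    setT `&` (fun t : BE * BE => distE t.1 t.2) @^-1` `[r, +oo[).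
  exact: measurable_distE.
rewrite setTI; apply/seteqP.
by split=> t; rewrite /far_pairs /preimage/= in_itv/= andbT.
Qed.

Lemma coupling_le_enlarge mu nu pi C r : coupling mu nu pi ->
  measurable (C : set BE) ->
  (mu C <= nu (enlarge C r) + pi (far_pairs r))%E.
Proof.
move=> cpl mC; have mCr := enlarge_borel C r.
have mfar := measurable_far_pairs r.
have [<- _] := cpl C mC; have [_ <-] := cpl _ mCr.
have mCr2 : measurable ([set: BE] `*` (enlarge C r : set BE)).
  exact: measurableX.
apply: le_trans (measureU2 pi mCr2 mfar).
apply: le_measure; rewrite ?inE; [exact: measurableX|exact: measurableU|].
move=> [c y] [/= Cc _]; have [cy|cy] := ltP (distE c y) r; last by right.
by left; split=> //; exists c => //; rewrite ball_distE.
Qed.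

Lemma far_pairs_le_transport_cost pi r : 0 < r ->
  ((r `^ p)%:E * pi (far_pairs r) <= transport_cost p pi)%E.
Proof.
move=> r0; have mcost := measurable_EFin_distp measurable_fst measurable_snd.
have := le_integral_abse pi measurableT mcost (powR_gt0 p r0).
under eq_integral do rewrite gee0_abs ?distp_ge0//.
apply: le_trans; rewrite lee_wpmul2l ?lee_fin ?powR_ge0//.
rewrite setTI (_ : [set t | _] = far_pairs r)//.
apply/seteqP; split=> t; rewrite /far_pairs/= lee_fin;
  by rewrite ger0_norm ?powR_ge0// ler_powR2r ?distE_ge0 ?(ltW r0).
Qed.

Lemma le_enlarge_wasserstein mu nu C r : Wp p mu -> Wp p nu ->
  measurable (C : set BE) -> 0 < r ->
  (mu C <= nu (enlarge C r) + ((W mu nu / r) `^ p)%:E)%E.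
Proof.
move=> Wmu Wnu mC r0; have rp0 : 0 < r `^ p by rewrite powR_gt0.
have nuCr : nu (enlarge C r) \is a fin_num.
  by apply: fin_num_measure; exact: enlarge_borel.
rewrite -leeBlDl// powRM ?wasserstein_ge0 ?invr_ge0 ?(ltW r0)//.
rewrite -powR_inv1 ?(ltW r0)// -powRrM mulN1r powRN mulrC EFinM lee_pdivlMl//.
rewrite (wasserstein_powR Wmu Wnu); apply: le_ereal_inf_tmp => _ [pi cpl <-].
apply: le_trans (far_pairs_le_transport_cost pi r0).
rewrite lee_wpmul2l ?lee_fin ?powR_ge0// leeBlDl//.
exact: coupling_le_enlarge.
Qed.

Lemma wasserstein_le_enlarge mu nu C r : Wp p mu -> Wp p nu ->
  measurable (C : set BE) -> 0 < r -> W mu nu <= r * r `^ p^-1 ->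
  (mu C <= nu (enlarge C r) + r%:E)%E.
Proof.
move=> Wmu Wnu mC r0 Wr.
apply: le_trans (le_enlarge_wasserstein Wmu Wnu mC r0) _.
rewrite leeD2l// lee_fin.
have rE : (r `^ p^-1) `^ p = r by rewrite -powRrM mulVf ?gt_eqF// powRr1// ltW.
rewrite -[leRHS]rE ler_powR2r ?powR_ge0//; last first.
  by rewrite divr_ge0 ?wasserstein_ge0 ?ltW.
by rewrite ler_pdivrMr// mulrC.
Qed.

(* A substitute for [W mu nu = 0] that spares the triangle inequality of [W]. *)
Definition wasserstein_approx mu nu := forall r, 0 < r ->
  exists2 tau, Wp p tau & W mu tau <= r /\ W tau nu <= r.

Lemma wasserstein_approxC mu nu :
  wasserstein_approx mu nu -> wasserstein_approx nu mu.
Proof.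
move=> mu_nu r /mu_nu[tau Wtau [mu_tau tau_nu]]; exists tau; first exact: Wtau.
by split; rewrite wassersteinC; [exact: tau_nu|exact: mu_tau].
Qed.

Lemma wasserstein_approx_closed_le mu nu C : Wp p mu -> Wp p nu ->
  wasserstein_approx mu nu -> closed C -> (mu C <= nu C)%E.
Proof.
move=> Wmu Wnu mu_nu cC; apply: closed_le_enlarge => // r r0.
have r20 : 0 < r / 2 by rewrite divr_gt0.
have [tau Wtau [mu_tau tau_nu]] := mu_nu _ (mulr_gt0 r20 (powR_gt0 p^-1 r20)).
have mC := closed_borel cC.
apply: le_trans (wasserstein_le_enlarge Wmu Wtau mC r20 mu_tau) _.
rewrite [in X in (_ <= X)%E](splitr r) EFinD addeA leeD2r//.
have mCh := enlarge_borel C (r / 2).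
apply: le_trans (wasserstein_le_enlarge Wtau Wnu mCh r20 tau_nu) _.
rewrite leeD2r// le_measure ?inE//; do 1?exact: enlarge_borel.
exact: enlargeD.
Qed.

Lemma wasserstein_approx_eqm mu nu : Wp p mu -> Wp p nu ->
  wasserstein_approx mu nu -> eqm mu nu.
Proof.
move=> Wmu Wnu mu_nu; apply: eqm_closed => C cC; apply/le_anti/andP; split.
  exact: wasserstein_approx_closed_le.
exact: wasserstein_approx_closed_le Wnu Wmu (wasserstein_approxC mu_nu) cC.
Qed.

End Enlargement.

(** * Rigidity *)

Section IsometricPushforward.
Variable psi : E -> E.
Hypothesis psiI : isometric psi.

Lemma measurable_isometric : measurable_fun setT (psi : BE -> BE).
Proof. by apply: continuous_borel_map; exact: isometric_continuous. Qed.

Lemma potential_law_isometric mu x :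
  potential (law mu measurable_isometric) (psi x) = potential mu x.
Proof.
by rewrite potential_law; apply: eq_integral => y _; rewrite /distp /distE psiI.
Qed.

Lemma Wp_law_isometric mu : Wp p mu -> Wp p (law mu measurable_isometric).
Proof.
move=> /(Wp_potential _ 0) Wmu; apply/(Wp_potential _ (psi 0)).
by rewrite potential_law_isometric.
Qed.

End IsometricPushforward.

Section Rigidity.
Variable ip : E -> E -> R.
Hypothesis ipN : inner_product_inducing_norm ip.
Variable Phi : probability BE R -> probability BE R.
Hypothesis Phi_bij : set_bij (Wp p) (Wp p) Phi.
Hypothesis Phi_iso : forall mu nu, Wp p mu -> Wp p nu ->
  W (Phi mu) (Phi nu) = W mu nu.

Let Wp_Phi mu : Wp p mu -> Wp p (Phi mu).
Proof. by have [stable _ _] := Phi_bij => Wmu; apply: stable. Qed.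

Let Phi_surj nu : Wp p nu -> exists2 mu, Wp p mu & Phi mu = nu.
Proof. by have [_ _ surj] := Phi_bij => /surj[mu]; exists mu. Qed.

Lemma extends_geodesics_Phi mu : Wp p mu ->
  extends_geodesics (Phi mu) <-> extends_geodesics mu.
Proof.
move=> Wmu; split=> mu_ext nu Wnu.
  have [_ /Phi_surj[eta Weta <-]] := mu_ext _ (Wp_Phi Wnu).
  by rewrite !Phi_iso//; exists eta.
have [nu' Wnu' <-] := Phi_surj Wnu; have [eta Weta eta_nu'] := mu_ext _ Wnu'.
by exists (Phi eta); [exact: Wp_Phi|rewrite !Phi_iso].
Qed.

Lemma is_dirac_Phi mu : Wp p mu ->
  (exists x, is_dirac (Phi mu) x) <-> (exists x, is_dirac mu x).
Proof.
move=> Wmu; have [PhiNmu muNPhi] := extends_geodesics_Phi Wmu; split=> -[x].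
  move/dirac_extends_geodesics/PhiNmu.
  exact: extends_geodesics_dirac ipN Wmu.
move/dirac_extends_geodesics/muNPhi.
exact: extends_geodesics_dirac ipN (Wp_Phi Wmu).
Qed.

Let Wp_delta x : Wp p \d_(x : BE).
Proof. exact: Wp_dirac (is_dirac_dirac x). Qed.

Lemma point_map_exists :
  exists psi : E -> E, forall x, is_dirac (Phi \d_(x : BE)) (psi x).
Proof.
have /choice[psi psiP] x : exists y, is_dirac (Phi \d_(x : BE)) y.
  by apply/(is_dirac_Phi (Wp_delta x)); exists x; exact: is_dirac_dirac.
by exists psi.
Qed.

Variable psi : E -> E.
Hypothesis psiP : forall x, is_dirac (Phi \d_(x : BE)) (psi x).

Lemma point_map_isometric : isometric psi.
Proof.
move=> x y; have := Phi_iso (Wp_delta x) (Wp_delta y).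
rewrite (wasserstein_diracs (psiP x) (psiP y)).
by rewrite (wasserstein_diracs (is_dirac_dirac x) (is_dirac_dirac y)).
Qed.

Lemma point_map_surj y : exists x, psi x = y.
Proof.
have [mu Wmu muE] := Phi_surj (Wp_delta y).
have [x mux] : exists x, is_dirac mu x.
  by apply/(is_dirac_Phi Wmu); exists y; rewrite muE; exact: is_dirac_dirac.
exists x; apply: distE_eq0; have := Phi_iso (Wp_delta x) Wmu.
rewrite muE (wasserstein_diracs (psiP x) (is_dirac_dirac y)) => ->.
by rewrite (wasserstein_diracs (is_dirac_dirac x) mux) distExx.
Qed.

Lemma potential_Phi mu x : Wp p mu ->
  potential (Phi mu) (psi x) = potential mu x.
Proof.
move=> Wmu; rewrite -(wasserstein_dirac (Wp_Phi Wmu) (psiP x)) Phi_iso//.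
exact: wasserstein_dirac Wmu (is_dirac_dirac x).
Qed.

Hypothesis peven : ~ exists k : nat, p = (2 * k)%:R.
Local Notation pushforward_psi mu :=
  (law mu (measurable_isometric point_map_isometric)).

Lemma Phi_eqm_pushforward_atomic mu (D : set E) : Wp p mu -> countable D ->
  mu D = 1%E -> eqm (Phi mu) (pushforward_psi mu).
Proof.
move=> Wmu cD muD; apply: eqm_sym.
have mT1 (x : BE) : measurable [set x] by exact: set1_borel.
have mD := countable_measurable mT1 cD.
have cpsiD := sub_countable (card_image_le psi D) cD.
have Wpush := Wp_law_isometric point_map_isometric Wmu.
apply: (eqm_countable_atoms mT1 cpsiD).
  have mpre : measurable (psi @^-1` (psi @` D) : set BE).
    rewrite -[X in measurable X]setTI.
    exact: (measurable_isometric point_map_isometric measurableT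
      (countable_measurable mT1 cpsiD)).
  by apply: (probability1_sub mD mpre _ muD) => x Dx; exists x.
apply: (eq_potential_atoms ipN peven Wpush (Wp_Phi Wmu)) => y.
have [x <-] := point_map_surj y.
by rewrite potential_law_isometric potential_Phi.
Qed.

Lemma Phi_eqm_pushforward mu : Wp p mu -> eqm (Phi mu) (pushforward_psi mu).
Proof.
move=> Wmu; have Wpush := Wp_law_isometric point_map_isometric Wmu.
apply: (wasserstein_approx_eqm (Wp_Phi Wmu) Wpush) => r r0.
have [f [mf cf f_near]] := countable_range_approx sepE r0.
have mu_id : eqm (law mu m_id) mu by [].
have Wf : Wp p (law mu mf).
  apply: (Wp_law_close mf (mg := m_id) (ltW r0) f_near).
  exact: Wp_eqm (eqm_sym mu_id) Wmu.
have f_range : law mu mf (range f) = 1%E.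
  rewrite -[RHS](@probability_setT _ _ _ mu); congr (mu _).
  by apply/seteqP; split=> // x _; exists x.
have mpsif : measurable_fun setT (psi \o f : BE -> BE).
  exact: measurableT_comp (measurable_isometric point_map_isometric) mf.
have Phi_f : eqm (Phi (law mu mf)) (law mu mpsif).
  exact: Phi_eqm_pushforward_atomic Wf cf f_range.
exists (Phi (law mu mf)); first exact: Wp_Phi.
split; rewrite wassersteinC.
  rewrite (Phi_iso Wf Wmu) -(eqm_wasserstein _ mu_id).
  exact: (wasserstein_law_le mu mf m_id (ltW r0) f_near).
rewrite (eqm_wasserstein _ Phi_f).
apply: (wasserstein_law_le mu _ mpsif (ltW r0)) => x.
by rewrite distEC /distE point_map_isometric; exact: f_near.
Qed.

End Rigidity.

End Wasserstein.

Unset Implicit Arguments.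

Theorem theorem3p10 (R : realType) (E : completeNormedModType R)
    (HE : hilbert_space E) (sepE : separable_space E)
    (p : R) (hp1 : 1 <= p) (hpeven : ~ exists k : nat, p = (2 * k)%:R)
    (Phi : probability (borel E) R -> probability (borel E) R)
    (Phi_bij : set_bij (Wp p) (Wp p) Phi)
    (Phi_iso : forall mu nu, Wp p mu -> Wp p nu ->
       wasserstein p (Phi mu) (Phi nu) = wasserstein p mu nu) :
  exists psi : E -> E,
    [/\ bijective psi,
        (forall x y, `|psi x - psi y| = `|x - y|),
        (forall (x y : E) (t : R),
           psi (t *: x + (1 - t) *: y) = t *: psi x + (1 - t) *: psi y)
      & forall mu, Wp p mu ->
          forall A : set (borel E), measurable A ->
            Phi mu A = pushforward mu (psi : borel E -> borel E) A].
Proof.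
have [ip ipN] := HE.
have [psi psiP] := point_map_exists sepE hp1 ipN Phi_bij Phi_iso.
have psiI := point_map_isometric sepE hp1 Phi_iso psiP.
have psi_surj := point_map_surj sepE hp1 ipN Phi_bij Phi_iso psiP.
exists psi; split.
- exact: isometric_surj_bij psiI psi_surj.
- exact: psiI.
- exact: (isometric_affine ipN psiI).
- exact: (Phi_eqm_pushforward sepE hp1 ipN Phi_bij Phi_iso psiP hpeven).
Qed.
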